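(* Let $\mathcal{R}=(r_i,\rho_i)_{i\ge1}$ be a sequence of matching pairs that fulfills the Conditions with limit value $r\in[\frac13,\frac35]$ (as defined in the context). Then the Hausdorff dimension of the Hanoi attractor $K$ with respect to the resistance metric $R_{\mathcal{R}}$ is $$\dim_{H,R_{\mathcal{R}}}(K)=\frac{\ln 3}{-\ln r}.$$
   Context: Hanoi attractor. Let $p_1,p_2,p_3\in\mathbb{R}^2$ be the vertices of an equilateral triangle of side length 1, fix $\alpha\in(0,1)$, let $\mathcal{A}=\{1,2,3\}$ and $G_i(x)=\frac{1-\alpha}{2}(x-p_i)+p_i$ for $i\in\mathcal{A}$. Let $e_1$ be the open line segment between $G_2(p_3)$ and $G_3(p_2)$, $e_2$ the one between $G_1(p_3)$ and $G_3(p_1)$, $e_3$ the one between $G_1(p_2)$ and $G_2(p_1)$. $K$ is the unique nonempty compact set with $K=G_1(K)\cup G_2(K)\cup G_3(K)\cup e_1\cup e_2\cup e_3$. For $w=w_1\cdots w_m\in\mathcal{A}^m$, $m\ge0$, put $G_w=G_{w_1}\circ\cdots\circ G_{w_m}$ ($G_w=\mathrm{id}$ for the empty word) and $e_i^w=G_w(e_i)$. Resistance forms. A matching pair is $(r,\rho)$ with $r,\rho>0$ and $\frac53r+\rho=1$. For a sequence of matching pairs $\mathcal{R}=(r_i,\rho_i)_{i\ge1}$ put $\delta_m=r_1\cdots r_m$ ($\delta_0=1$) and $\gamma_m=r_1\cdots r_{m-1}\rho_m$. For $u:K\to\mathbb{R}$ let $Q_0^\Sigma(u,u)=(u(p_1)-u(p_2))^2+(u(p_2)-u(p_3))^2+(u(p_3)-u(p_1))^2$,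 $Q_m^\Sigma(u,u)=\sum_{w\in\mathcal{A}^m}Q_0^\Sigma(u\circ G_w,u\circ G_w)$, $\mathcal{E}_{\mathcal{R}}^\Sigma(u,u)=\lim_{m\to\infty}\frac1{\delta_m}Q_m^\Sigma(u,u)$. Let $\xi_{e_i^w}:(0,1)\to e_i^w$ be the affine parametrization of $e_i^w$ from one endpoint to the other, $\mathcal{D}_k^I(u,u)=\sum_{w\in\mathcal{A}^{k-1},\,i\in\{1,2,3\}}\int_0^1\big(\frac{d(u\circ\xi_{e_i^w})}{dx}\big)^2dx$, $\mathcal{E}_{\mathcal{R}}^I(u,u)=\sum_{k=1}^\infty\frac1{\gamma_k}\mathcal{D}_k^I(u,u)$. Then $\mathcal{E}_{\mathcal{R}}=\mathcal{E}_{\mathcal{R}}^\Sigma+\mathcal{E}_{\mathcal{R}}^I$ with domain $\mathcal{F}_{\mathcal{R}}=\{u\in C(K):\mathcal{E}_{\mathcal{R}}(u,u)<\infty,\ u\circ\xi_{e_i^w}\in H^1(0,1)\text{ for all }w\in\mathcal{A}^m,\,m\ge0,\,i\in\{1,2,3\}\}$; it is known that this is a regular resistance form on $K$. The resistance metric is $R_{\mathcal{R}}(x,y)=\big(\min\{\mathcal{E}_{\mathcal{R}}(u,u):u\in\mathcal{F}_{\mathcal{R}},\,u(x)=0,\,u(y)=1\}\big)^{-1}$ for $x\ne y$, and $R_{\mathcal{R}}(x,x)=0$. $\dim_{H,R_{\mathcal{R}}}$ denotes Hausdorff dimension in the metric space $(K,R_{\mathcal{R}})$. Conditions. $\mathcal{R}$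 fulfills the Conditions with limit value $r\in[\frac13,\frac35]$ if: in case $\frac13\le r<\frac35$, $\sum_{i\ge1}|r-r_i|<\infty$; in case $r=\frac35$, $\sum_{i\ge1}\rho_i<\infty$ and $(r_i)_{i\ge1}$ is monotonically increasing. *)

(* Defs.v *)
From mathcomp Require Import all_boot all_order all_algebra.
From mathcomp Require Import all_classical all_reals all_analysis.
Import Order.TTheory GRing.Theory Num.Theory.
Import numFieldNormedType.Exports.

Set Implicit Arguments.
Unset Strict Implicit.
Unset Printing Implicit Defensive.

Local Open Scope classical_set_scope.
Local Open Scope ring_scope.

(* The norm of the library on 'rV[R]_2 is the sup norm, hence this distance. *)
Definition edist (R : realType) (x y : 'rV[R]_2) : R :=
  Num.sqrt (\sum_(k < 2) (x 0 k - y 0 k) ^+ 2).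

Definition unit_equilateral (R : realType) (p : 'I_3 -> 'rV[R]_2) : Prop :=
  forall i j : 'I_3, i != j -> edist (p i) (p j) = 1.

Definition Gmap (R : realType) (p : 'I_3 -> 'rV[R]_2) (alpha : R) (i : 'I_3)
    (x : 'rV[R]_2) : 'rV[R]_2 :=
  ((1 - alpha) / 2) *: (x - p i) + p i.

(* G_w = G_{w_1} o ... o G_{w_m}, the first letter being outermost. *)
Definition Gword (R : realType) (p : 'I_3 -> 'rV[R]_2) (alpha : R)
    (w : seq 'I_3) (x : 'rV[R]_2) : 'rV[R]_2 :=
  foldr (Gmap p alpha) x w.

(* Affine parametrization of e_i^w = G_w(e_i), where e_i joins G_j(p_k) and
   G_k(p_j); here j and k are the cyclic successor and predecessor of i. *)
Definition edge_param (R : realType) (p : 'I_3 -> 'rV[R]_2) (alpha : R)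
    (w : seq 'I_3) (i : 'I_3) (t : R) : 'rV[R]_2 :=
  Gword p alpha w
    ((1 - t) *: Gmap p alpha (ordS i) (p (ord_pred i)) +
     t *: Gmap p alpha (ord_pred i) (p (ordS i))).

Definition edge (R : realType) (p : 'I_3 -> 'rV[R]_2) (alpha : R)
    (w : seq 'I_3) (i : 'I_3) : set 'rV[R]_2 :=
  edge_param p alpha w i @` `]0, 1[.

Definition hanoi_attractor (R : realType) (p : 'I_3 -> 'rV[R]_2) (alpha : R)
    (K : set 'rV[R]_2) : Prop :=
  [/\ K !=set0, compact K &
      K = (\bigcup_i (Gmap p alpha i @` K)) `|`
          (\bigcup_i (edge p alpha [::] i))].

Definition matching_pair (R : realType) (r rho : R) : Prop :=
  [/\ 0 < r, 0 < rho & 5 / 3 * r + rho = 1].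

(* Sequences are indexed from 0: r_ k and rho_ k stand for r_{k+1} and
   rho_{k+1}; the index m of delta and gamma is the usual one, m >= 1 for
   gamma. *)
Definition delta (R : realType) (r_ : nat -> R) (m : nat) : R :=
  \prod_(i < m) r_ i.

Definition gamma (R : realType) (r_ rho_ : nat -> R) (m : nat) : R :=
  delta r_ m.-1 * rho_ m.-1.

Definition Q0 (R : realType) (p : 'I_3 -> 'rV[R]_2) (u : 'rV[R]_2 -> R) : R :=
  \sum_(i < 3) (u (p i) - u (p (ordS i))) ^+ 2.

Definition QSigma (R : realType) (p : 'I_3 -> 'rV[R]_2) (alpha : R)
    (m : nat) (u : 'rV[R]_2 -> R) : R :=
  \sum_(w : m.-tuple 'I_3) Q0 p (u \o Gword p alpha w).

(* For continuous u that is H^1 along the edges, this limit exists as soon as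
   energyI below is finite; otherwise the value of limn is still >= 0, so that
   the total energy is +oo. *)
Definition energySigma (R : realType) (p : 'I_3 -> 'rV[R]_2) (alpha : R)
    (r_ : nat -> R) (u : 'rV[R]_2 -> R) : \bar R :=
  limn (fun m => ((delta r_ m)^-1 * QSigma p alpha m u)%:E).

Definition L2_01 (R : realType) (f : R -> R) : Prop :=
  measurable_fun (`]0, 1[ : set R) f /\
  (\int[lebesgue_measure]_(x in `]0%R, 1%R[) ((f x) ^+ 2)%:E < +oo)%E.

Definition test_function_01 (R : realType) (phi : R -> R) : Prop :=
  [/\ forall x, derivable phi x 1,
      continuous (derive1 phi) &
      exists a b : R,
        [/\ 0 < a, b < 1 & [set x | phi x != 0] `<=` `[a, b]]].

(* As is usual in dimension one, the test functions range over C^1_c(0,1). *)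
Definition weak_derivative_01 (R : realType) (f g : R -> R) : Prop :=
  forall phi : R -> R, test_function_01 phi ->
    \int[lebesgue_measure]_(x in `]0, 1[) (f x * derive1 phi x) =
    - \int[lebesgue_measure]_(x in `]0, 1[) (g x * phi x).

Definition H1_01 (R : realType) (f : R -> R) : Prop :=
  L2_01 f /\ exists g : R -> R, L2_01 g /\ weak_derivative_01 f g.

(* A chosen L^2 weak derivative (unique a.e.); junk unless f is in H^1(0,1). *)
Definition wderiv_01 (R : realType) (f : R -> R) : R -> R :=
  xget (fun=> 0) [set g | L2_01 g /\ weak_derivative_01 f g].

(* DI k is the k-th Dirichlet integral for k >= 1: words have length k - 1. *)
Definition DI (R : realType) (p : 'I_3 -> 'rV[R]_2) (alpha : R)
    (k : nat) (u : 'rV[R]_2 -> R) : \bar R :=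
  (\sum_(w : k.-1.-tuple 'I_3) \sum_(i < 3)
    \int[lebesgue_measure]_(x in `]0%R, 1%R[)
      ((wderiv_01 (u \o edge_param p alpha w i) x) ^+ 2)%:E)%E.

Definition energyI (R : realType) (p : 'I_3 -> 'rV[R]_2) (alpha : R)
    (r_ rho_ : nat -> R) (u : 'rV[R]_2 -> R) : \bar R :=
  (\sum_(1 <= k <oo) ((gamma r_ rho_ k)^-1)%:E * DI p alpha k u)%E.

(* Functions on K are represented by functions on the plane; the energies and
   the domain below only depend on their values on K. *)
Definition energy (R : realType) (p : 'I_3 -> 'rV[R]_2) (alpha : R)
    (r_ rho_ : nat -> R) (u : 'rV[R]_2 -> R) : \bar R :=
  (energySigma p alpha r_ u + energyI p alpha r_ rho_ u)%E.

Definition energy_domain (R : realType) (p : 'I_3 -> 'rV[R]_2) (alpha : R)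
    (r_ rho_ : nat -> R) (K : set 'rV[R]_2) : set ('rV[R]_2 -> R) :=
  [set u | [/\ {within K, continuous u},
               (energy p alpha r_ rho_ u < +oo)%E &
               forall (w : seq 'I_3) (i : 'I_3),
                 H1_01 (u \o edge_param p alpha w i)]].

(* The infimum over u is the (attained) minimum of the energy. *)
Definition resistance_metric (R : realType) (p : 'I_3 -> 'rV[R]_2) (alpha : R)
    (r_ rho_ : nat -> R) (K : set 'rV[R]_2) (x y : 'rV[R]_2) : R :=
  if x == y then 0 else
  (fine (ereal_inf (energy p alpha r_ rho_ @`
    [set u | [/\ energy_domain p alpha r_ rho_ K u, u x = 0 & u y = 1]])))^-1.

(* Hausdorff dimension of a set A for a distance d given on A; covering sets
   may be taken inside A, and are allowed to be empty (at no cost), so that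
   countable covers include the finite ones. *)
Definition diam (R : realType) (T : Type) (d : T -> T -> R) (U : set T) :
    \bar R :=
  ereal_sup [set (d z.1 z.2)%:E | z in U `*` U].

Definition diam_pow (R : realType) (T : Type) (d : T -> T -> R) (s : R)
    (U : set T) : \bar R :=
  if U == set0 then 0%E else (diam d U `^ s)%E.

Definition hausdorff_premeasure (R : realType) (T : Type) (d : T -> T -> R)
    (s eps : R) (A : set T) : \bar R :=
  ereal_inf [set (\sum_(0 <= n <oo) diam_pow d s (U n))%E |
    U in [set U : nat -> set T |
      \bigcup_n U n = A /\ forall n, (diam d (U n) <= eps%:E)%E]].

Definition hausdorff_measure (R : realType) (T : Type) (d : T -> T -> R)
    (s : R) (A : set T) : \bar R :=
  ereal_sup [set hausdorff_premeasure d s eps A | eps in [set eps : R | 0 < eps]].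

Definition hausdorff_dim (R : realType) (T : Type) (d : T -> T -> R)
    (A : set T) : \bar R :=
  ereal_inf [set s%:E | s in [set s : R |
    0 <= s /\ hausdorff_measure d s A = 0%E]].

Definition fulfills_conditions (R : realType) (r_ rho_ : nat -> R) (r : R) :
    Prop :=
  (1 / 3 <= r < 3 / 5 -> cvgn (series (fun i => `|r - r_ i|))) /\
  (r = 3 / 5 -> cvgn (series rho_) /\ nondecreasing_seq r_).

(* Main.v *)
Require Import Defs.
From mathcomp Require Import all_boot all_order all_algebra.
From mathcomp Require Import all_classical all_reals all_analysis.
From mathcomp Require Import measurable_realfun ring lra.
Import Order.TTheory GRing.Theory Num.Theory.
Import numFieldNormedType.Exports.
Local Open Scope classical_set_scope.
Local Open Scope ring_scope.

Set Implicit Arguments.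
Unset Strict Implicit.

(** Everything reduces to the growth of [delta r_ m], the resistance scale of
cells of level [m]: as [r_ i] tends to [r], [delta r_ m] behaves like [r ^+ m]
up to subexponential factors, there are [3 ^ m] cells of level [m], and hence
the dimension is [ln 3 / - ln r].

Energies are computed on trees of vertex values. For a matching pair the
harmonic extension of vertex values to the three subcells is linear in [r]
and preserves the energy ([vertex_form_extend], [edge_form_extend]), and it
minimizes the energy ([trace_le]). Two estimates follow.

- Upper bound. By minimality, the renormalized vertex sums plus the energy of
  the edges seen so far increase with the level, so each of them is at most
  the energy ([energy_ge_QSigma], [edge_osc]). Chaining these estimates
  through a cell of level [m] bounds its diameter by [40 ^+ 2 * delta r_ m]
  ([resistance_cell_le]), while an edge is parametrized without increasing
  distances ([resistance_edge_le]). Covering [K] by the cells of level [m]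
  and by short pieces of the finitely many edges outside them shows that the
  [s]-dimensional measure vanishes for [s > ln 3 / - ln r]; as [1 / 3 <= r],
  this exponent is at least 1, and then the edges have measure 0.

- Lower bound. Let [w] be a word of length [m] and let [i <> j]. Setting the
  value 0 at the vertices of the cell [w], the value 1 at all the other
  vertices of its subcells and at all vertices of the subsubcell [w i j], and
  extending harmonically where the values are not yet prescribed, one gets a
  function of energy [6 / delta r_ (m + 2)] which is 0 outside the cell [w]
  and 1 on the cell [w i j] ([energy_tree], [vertex_sum_bump]). So these two
  sets are at distance at least [delta r_ (m + 2) / 6]
  ([resistance_separated_ge]). A point of [K] whose address contains two
  distinct consecutive letters at prescribed places is thereby separated, at
  every scale, from the points with another address; transporting Lebesgue
  measure from the unit interval to such points gives the lower bound by the
  mass distribution principle ([hausdorff_measure_below]).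

The weak derivatives chosen in the energy are tied to pointwise differences
by testing against smoothed indicators ([weak_derivative_FTC]). *)

(** * Weak derivatives on the unit interval *)

Section ramps.
Context {R : realType}.

(** A quadratic Taylor remainder makes the difference quotient converge. This
differentiates piecewise quadratic functions without isolating their break
points. *)
Lemma is_derive_quadratic (f : R -> R) (x a C : R) :
  (forall y, `|f y - f x - a * (y - x)| <= C * (y - x) ^+ 2) ->
  is_derive x 1 f a.
Proof.
move=> H.
have C0 : 0 <= C.
  have := H (x + 1); rewrite [x + 1 - x]addrC addKr expr1n !mulr1.
  by move=> H1; exact: le_trans (normr_ge0 _) H1.
have cv : h^-1 *: (f (h *: 1 + x) - f x) @[h --> 0^'] --> a.
  apply/cvgrPdist_le => e e0; near=> h.
  have h0 : h != 0 by near: h; exact: nbhs_dnbhs_neq.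
  rewrite [h *: 1]mulr1.
  have := H (h + x); rewrite addrK => Hh.
  have -> : a - h^-1 *: (f (h + x) - f x) = - (h^-1 * (f (h + x) - f x - a * h)).
    by rewrite /GRing.scale /=; field.
  rewrite normrN normrM normfV ler_pdivrMl ?normr_gt0//.
  apply: le_trans Hh _; rewrite -[h ^+ 2]ger0_norm ?sqr_ge0// normrX expr2 mulrA.
  rewrite [leRHS]mulrC ler_wpM2r//.
  have : `|h| <= e / (C + 1).
    near: h; apply: dnbhs0_le; rewrite divr_gt0//; lra.
  rewrite ler_pdivlMr; last lra.
  have := normr_ge0 h; nra.
apply: DeriveDef; first by apply/cvg_ex; exists a.
by apply/cvg_lim.
Unshelve. all: by end_near. Qed.

Definition pos_part (t : R) : R := Num.max t 0.

(** Half the second difference of the square of the positive part: a C^1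
function that rises from 0 at 0 to 1 at 2 and has derivative [tent]. *)
Definition smooth_step (t : R) : R :=
  (pos_part t ^+ 2 - 2 * pos_part (t - 1) ^+ 2 + pos_part (t - 2) ^+ 2) / 2.

Definition tent (t : R) : R := pos_part t - 2 * pos_part (t - 1) + pos_part (t - 2).

Lemma pos_partE t : pos_part t = 0 /\ t <= 0 \/ pos_part t = t /\ 0 <= t.
Proof. by rewrite /pos_part; case: (leP t 0) => h; [left|right; split=> //; lra]. Qed.

Lemma pos_part_continuous : continuous pos_part.
Proof. by move=> x; apply: continuous_max; [exact: cvg_id|exact: cvg_cst]. Qed.

Lemma pos_part_sqr_taylor s t :
  0 <= pos_part t ^+ 2 - pos_part s ^+ 2 - 2 * pos_part s * (t - s) <= (t - s) ^+ 2.
Proof.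
have h1 := sqr_ge0 (t - s); have h2 := sqr_ge0 s; have h3 := sqr_ge0 t.
case: (pos_partE s) => [[-> ?]|[-> ?]]; case: (pos_partE t) => [[-> ?]|[-> ?]];

  try have h4 : 0 <= s * - t by [apply: mulr_ge0; lra]; rewrite ?expr2 in h1 h2 h3 *;
 apply/andP; split; nra.
Qed.

Lemma is_derive_smooth_step_scaled (a h x : R) : 0 < h ->
  is_derive x 1 (fun x => smooth_step ((x - a) / h)) (tent ((x - a) / h) / h).
Proof.
move=> h0; apply: (@is_derive_quadratic _ _ _ (2 / h ^+ 2)) => y.
set s := (x - a) / h; set t := (y - a) / h.
have -> : y - x = h * (t - s) by rewrite /t /s; field; rewrite gt_eqF.
have -> : tent s / h * (h * (t - s)) = tent s * (t - s).
  by field; rewrite gt_eqF.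
have -> : 2 / h ^+ 2 * (h * (t - s)) ^+ 2 = 2 * (t - s) ^+ 2.
  by field; rewrite gt_eqF.
have e1 := pos_part_sqr_taylor s t.
have e2 := pos_part_sqr_taylor (s - 1) (t - 1).
have e3 := pos_part_sqr_taylor (s - 2) (t - 2).
rewrite /smooth_step /tent ler_norml.
have E c : t - c - (s - c) = t - s by ring.
move: e1 e2 e3; rewrite !E => /andP[? ?] /andP[? ?] /andP[? ?].
apply/andP; split; lra.
Qed.

Lemma pos_part_sub_continuous c : continuous (fun x => pos_part (x - c)).
Proof.
move=> x; apply: (@cvg_comp _ _ _ (fun x => x - c) pos_part _ (nbhs (x - c))).
  by apply: cvgB; [exact: cvg_id|exact: cvg_cst].
exact: pos_part_continuous.
Qed.

Lemma tent_continuous : continuous tent.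
Proof.
move=> x; rewrite /tent; apply: cvgD; [apply: cvgB|]; [exact: pos_part_continuous| |].
  apply: cvgM; first exact: cvg_cst.
  exact: pos_part_sub_continuous.
exact: pos_part_sub_continuous.
Qed.

Local Ltac ramp_cases t :=
  case: (pos_partE t) => [[-> ?]|[-> ?]]; case: (pos_partE (t - 1)) => [[-> ?]|[-> ?]];
  case: (pos_partE (t - 2)) => [[-> ?]|[-> ?]].

Lemma smooth_step_le0 t : t <= 0 -> smooth_step t = 0.
Proof.
by move=> ?; rewrite /smooth_step; ramp_cases t; nra.
Qed.

Lemma smooth_step_ge2 t : 2 <= t -> smooth_step t = 1.
Proof.
by move=> ?; rewrite /smooth_step; ramp_cases t; nra.
Qed.

Lemma smooth_step_ge0 t : 0 <= smooth_step t.
Proof.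
rewrite /smooth_step; ramp_cases t; nra.
Qed.

Lemma smooth_step_le1 t : smooth_step t <= 1.
Proof.
rewrite /smooth_step; ramp_cases t; nra.
Qed.

Lemma tent_ge0 t : 0 <= tent t.
Proof.
rewrite /tent; ramp_cases t; nra.
Qed.

Lemma tent_le1 t : tent t <= 1.
Proof.
rewrite /tent; ramp_cases t; nra.
Qed.

Lemma tent_out t : t <= 0 \/ 2 <= t -> tent t = 0.
Proof.
by case=> ?; rewrite /tent; ramp_cases t; nra.
Qed.


End ramps.

Section tents.
Context {R : realType}.
Notation mu := (@lebesgue_measure R).
Local Notation I01 := (`]0%R, 1%R[%classic : set R).
Local Notation S a h := (fun x : R => smooth_step ((x - a) / h)).
Local Notation T a h := (fun x : R => tent ((x - a) / h) / h).

Lemma smooth_step_scaled_continuous (a h : R) : 0 < h -> continuous (S a h).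
Proof.
move=> h0 x; apply: differentiable_continuous; apply/derivable1_diffP.
exact: (@ex_derive _ _ _ _ _ _ _ (is_derive_smooth_step_scaled a x h0)).
Qed.

Lemma tent_scaled_continuous (a h : R) : continuous (T a h).
Proof.
move=> x; apply: cvgMl.
apply: (@cvg_comp _ _ _ (fun x => (x - a) / h) tent _ (nbhs ((x - a) / h))).
  by apply: cvgMl; apply: cvgB; [exact: cvg_id|exact: cvg_cst].
exact: tent_continuous.
Qed.

Lemma integrable_mulr_bounded (f k : R -> R) (C : R) :
  mu.-integrable I01 (EFin \o f) -> continuous k -> (forall x, `|k x| <= C) ->
  mu.-integrable I01 (EFin \o (fun x => f x * k x)).
Proof.
move=> fi kc kC.
have := @integrableMl _ _ _ mu I01 _ (EFin \o f) k fi.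
rewrite (_ : ((EFin \o f) \* (EFin \o k))%E = EFin \o (fun x => f x * k x)).
  apply=> //; first by apply: measurable_funTS; apply: continuous_measurable_fun.
  exists C; split; first exact: num_real.
  move=> M CM x _ /=; exact: le_trans (kC x) (ltW CM).
by apply/funext.
Qed.

Lemma tent_scaled_bound (a h : R) x : 0 < h -> `|T a h x| <= h^-1.
Proof.
move=> h0; rewrite ger0_norm.
  by apply: ler_piMl; [rewrite invr_ge0 ltW|exact: tent_le1].
by rewrite divr_ge0 ?tent_ge0// ltW.
Qed.

Lemma integrable_cont01 (f : R -> R) : continuous f ->
  mu.-integrable I01 (EFin \o f).
Proof.
move=> fc; apply: (@integrableS _ _ _ mu `[0, 1]%classic) => //.
  exact: subset_itv_oo_cc.
apply: continuous_compact_integrable; first exact: segment_compact.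
exact/continuous_subspaceT.
Qed.

Lemma integrable_cst01 (c : R) : mu.-integrable I01 (EFin \o cst c).
Proof.
by apply: integrable_cont01; exact: cst_continuous.
Qed.

Lemma integrable_subr (D : set R) (f g : R -> R) : measurable D ->
  mu.-integrable D (EFin \o f) -> mu.-integrable D (EFin \o g) ->
  mu.-integrable D (EFin \o (fun x => f x - g x)).
Proof.
move=> mD fi gi.
rewrite (_ : EFin \o _ = ((EFin \o f) \- (EFin \o g))%E); first exact: integrableB.
by apply/funext => x /=; rewrite EFinB.
Qed.

Lemma integrable_mulr_cst (D : set R) (c : R) (f : R -> R) : measurable D ->
  mu.-integrable D (EFin \o f) -> mu.-integrable D (EFin \o (fun x => c * f x)).
Proof.
move=> mD fi; rewrite (_ : EFin \o _ = (fun x => c%:E * (EFin \o f) x)%E).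
  exact: integrableZl.
by apply/funext => x /=; rewrite EFinM.
Qed.

Lemma Rintegral_tent_scaled (a h : R) : 0 < h -> 0 <= a -> a + 2 * h <= 1 ->
  \int[mu]_(x in I01) T a h x = 1.
Proof.
move=> h0 a0 a1.
have it : mu.-integrable `[0, 1] (EFin \o T a h).
  apply: continuous_compact_integrable; first exact: segment_compact.
  exact/continuous_subspaceT/tent_scaled_continuous.
have -> : \int[mu]_(x in I01) T a h x = \int[mu]_(x in `[0, 1]) T a h x.
  rewrite -Rintegral_itv_obnd_cbnd; last first.
    apply: integrableS it => //; exact: subset_itv_oc_cc.
  rewrite -Rintegral_itv_bndo_bndc//.
  apply: integrableS it => //; exact: subset_itv_oo_cc.
rewrite /Rintegral (@continuous_FTC2 _ _ (S a h))//.
- rewrite /= smooth_step_ge2 ?smooth_step_le0 ?subr0//.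
  + by rewrite sub0r pmulr_lle0 ?invr_gt0// oppr_le0.
  + by rewrite ler_pdivlMr//; lra.
- exact/continuous_subspaceT/tent_scaled_continuous.
- split=> [x _| |].
  + exact: (@ex_derive _ _ _ _ _ _ _ (is_derive_smooth_step_scaled a x h0)).
  + exact/cvg_at_right_filter/smooth_step_scaled_continuous.
  + exact/cvg_at_left_filter/smooth_step_scaled_continuous.
- move=> x _; rewrite derive1E.
  exact: (@derive_val _ _ _ _ _ _ _ (is_derive_smooth_step_scaled a x h0)).
Qed.

(** The scaled tents have integral 1 and concentrate to the right of [a]: they
form an approximate identity. *)
Lemma Rintegral_tent_cvg (f : R -> R) (a : R) (h_ : nat -> R) :
  mu.-integrable I01 (EFin \o f) -> 0 <= a -> (forall n, 0 < h_ n) ->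
  (forall n, a + 2 * h_ n <= 1) -> h_ @ \oo --> 0 -> {for a, continuous f} ->
  \int[mu]_(x in I01) (f x * T a (h_ n) x) @[n --> \oo] --> f a.
Proof.
move=> fi a0 h0 h1 hcv fa; apply/cvgrPdist_le => e e0.
move/cvgrPdist_le : (fa) => /(_ _ e0) [d /= d0 fd].
move/cvgrPdist_lt : hcv => /(_ (d / 2)); rewrite divr_gt0// => /(_ isT).
apply: filterS => n; rewrite sub0r normrN gtr0_norm// => hd.
have fTi := integrable_mulr_bounded fi (@tent_scaled_continuous a (h_ n))
  (fun x => tent_scaled_bound a x (h0 n)).
have cTi (c : R) : mu.-integrable I01 (EFin \o (fun x => c * T a (h_ n) x)).
  exact: (integrable_mulr_bounded (integrable_cst01 c) (@tent_scaled_continuous a (h_ n))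
  (fun x => tent_scaled_bound a x (h0 n))).
have Ti : mu.-integrable I01 (EFin \o T a (h_ n)).
  have := cTi 1; congr (mu.-integrable _ _); apply/funext => x /=.
  by rewrite mul1r.
have cT (c : R) : \int[mu]_(x in I01) (c * T a (h_ n) x) = c.
  by rewrite RintegralZl// Rintegral_tent_scaled// mulr1.
rewrite -{1}(cT (f a)) -RintegralB//.
apply: le_trans (le_normr_Rintegral _ _) _ => //.
  exact: integrable_subr.
rewrite -[leRHS]cT; apply: le_Rintegral => //.
- by apply: integrable_norm => //; exact: integrable_subr.
- move=> x _; rewrite -mulrBl normrM [`|T a (h_ n) x|]ger0_norm; last first.
    by rewrite divr_ge0 ?tent_ge0// ltW.
  have [xa|ax] := leP x a.
    rewrite tent_out ?mul0r ?mulr0//; left.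
    by rewrite pmulr_lle0 ?invr_gt0// subr_le0.
  have [xh|xh] := leP (a + 2 * h_ n) x.
    rewrite tent_out ?mul0r ?mulr0//; right.
    by rewrite ler_pdivlMr//; lra.
  rewrite ler_wpM2r ?divr_ge0 ?tent_ge0 ?(ltW (h0 n))//.
  apply: fd; rewrite /= ltr_distlC; lra.
Qed.

End tents.

Section plateaus.
Context {R : realType}.
Notation mu := (@lebesgue_measure R).
Local Notation I01 := (`]0%R, 1%R[%classic : set R).
Local Notation S a h := (fun x : R => smooth_step ((x - a) / h)).
Local Notation T a h := (fun x : R => tent ((x - a) / h) / h).

Lemma L2_integrable_sqr (f : R -> R) : L2_01 f ->
  mu.-integrable I01 (EFin \o (fun x => f x ^+ 2)).
Proof.
move=> [mf foo]; apply/integrableP; split.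
  by apply/measurable_EFinP; apply: measurable_funX.
under eq_integral do rewrite gee0_abs ?lee_fin ?sqr_ge0//.
exact: foo.
Qed.

Lemma L2_integrable (f : R -> R) : L2_01 f -> mu.-integrable I01 (EFin \o f).
Proof.
move=> Lf; have [mf _] := Lf.
apply: (@le_integrable _ _ _ mu _ _ _ (EFin \o (fun x => 1 + f x ^+ 2))) => //.
- exact/measurable_EFinP.
- move=> x _; rewrite /= lee_fin ler_norml [`|1 + _|]ger0_norm; last first.
    by rewrite addr_ge0 ?sqr_ge0.
  by apply/andP; split; nra.
- rewrite (_ : EFin \o _ = ((EFin \o cst 1%R) \+ (EFin \o (fun x => (f x ^+ 2)%R)))%E).
    apply: integrableD => //; first exact: integrable_cst01.
    exact: L2_integrable_sqr.
  by apply/funext => x /=; rewrite EFinD.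
Qed.

(** A C^1 approximation of the indicator of [`]a, b]], whose derivative is a
difference of two approximate identities. *)
Definition plateau (a b h : R) (x : R) : R := S a h x - S b h x.

Lemma is_derive_plateau (a b h x : R) : 0 < h ->
  is_derive x 1 (plateau a b h) (T a h x - T b h x).
Proof.
move=> h0; rewrite /plateau.
by apply: is_deriveB; exact: is_derive_smooth_step_scaled.
Qed.

Lemma derive1_plateau (a b h : R) : 0 < h ->
  derive1 (plateau a b h) = (fun x => T a h x - T b h x).
Proof.
move=> h0; apply/funext => x; rewrite derive1E.
exact: (@derive_val _ _ _ _ _ _ _ (is_derive_plateau a b x h0)).
Qed.

Lemma plateau_test (a b h : R) : 0 < h -> 0 < a -> a <= b -> b + 2 * h < 1 ->
  test_function_01 (plateau a b h).
Proof.
move=> h0 a0 ab b1; split.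
- move=> x; exact: (@ex_derive _ _ _ _ _ _ _ (is_derive_plateau a b x h0)).
- by rewrite derive1_plateau// => x; apply: cvgB; exact: tent_scaled_continuous.
- exists a, (b + 2 * h); split=> // x /= /eqP; apply: contra_notT.
  rewrite in_itv /= negb_and -!ltNge => /orP[xa|bx]; rewrite /plateau.
    by rewrite !smooth_step_le0 ?subrr// pmulr_lle0 ?invr_gt0//; lra.
  by rewrite !smooth_step_ge2 ?subrr// ler_pdivlMr//; lra.
Qed.

Lemma plateau_continuous (a b h : R) : 0 < h -> continuous (plateau a b h).
Proof. by move=> h0 x; apply: cvgB; exact: smooth_step_scaled_continuous. Qed.

Lemma plateau_bound (a b h x : R) : `|plateau a b h x| <= 1.
Proof.
rewrite /plateau ler_norml.
have := smooth_step_ge0 ((x - a) / h); have := smooth_step_ge0 ((x - b) / h).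
have := smooth_step_le1 ((x - a) / h); have := smooth_step_le1 ((x - b) / h).
by move=> *; apply/andP; split; lra.
Qed.

Lemma smooth_step_scaled_cvg (a x : R) (h_ : nat -> R) : (forall n, 0 < h_ n) ->
  h_ @ \oo --> 0 -> smooth_step ((x - a) / h_ n) @[n --> \oo] --> ((a < x)%R%:R : R).
Proof.
move=> h0 hcv; have [ax|xa] := ltP a x.
  apply: (@cvg_trans _ ((fun=> 1) @ \oo)); last exact: cvg_cst.
  apply: near_eq_cvg.
  move/cvgrPdist_lt : hcv => /(_ ((x - a) / 2)).
  rewrite divr_gt0 ?subr_gt0// => /(_ isT); apply: filterS => n.
  rewrite sub0r normrN gtr0_norm// => hn.
  by rewrite smooth_step_ge2// ler_pdivlMr//; lra.
apply: (@cvg_trans _ ((fun=> 0) @ \oo)); last exact: cvg_cst.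
apply: near_eq_cvg; apply: nearW => n.
by rewrite smooth_step_le0// pmulr_lle0 ?invr_gt0// subr_le0.
Qed.

(** Test the weak derivative against steeper and steeper plateaus. The integral
against [f] tends to [f a - f b], the derivative of a plateau being a difference
of approximate identities; the integral against [g] converges by domination. *)
Lemma weak_derivative_FTC (f g : R -> R) (a b : R) :
  mu.-integrable I01 (EFin \o f) -> mu.-integrable I01 (EFin \o g) ->
  weak_derivative_01 f g -> 0 < a -> a <= b -> b < 1 ->
  {for a, continuous f} -> {for b, continuous f} ->
  f b - f a = \int[mu]_(x in `]a, b]) g x.
Proof.
move=> fi gi fg a0 ab b1 fa fb.
pose h_ (n : nat) : R := (1 - b) / 3 * n.+1%:R^-1.
have h0 n : 0 < h_ n by rewrite mulr_gt0 ?divr_gt0 ?subr_gt0// invr_gt0.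
have h1 n : h_ n <= (1 - b) / 3.
  rewrite ler_piMr ?invf_le1//; first by rewrite divr_ge0// subr_ge0 ltW.
  by rewrite ler1n.
have hcv : h_ @ \oo --> 0.
  rewrite -[0](mulr0 ((1 - b) / 3)); apply: cvgMr; exact: cvg_harmonic.
have ca := Rintegral_tent_cvg fi (ltW a0) h0 _ hcv fa.
have cb := Rintegral_tent_cvg fi _ h0 _ hcv fb.
have hb n : b + 2 * h_ n < 1 by have := h1 n; lra.
have {ca}ca : \int[mu]_(x in I01) (f x * T a (h_ n) x) @[n --> \oo] --> f a.
  by apply: ca => n; have := hb n; lra.
have {cb}cb : \int[mu]_(x in I01) (f x * T b (h_ n) x) @[n --> \oo] --> f b.
  by apply: cb => [|n]; [lra|have := hb n; lra].
have E : (fun n => \int[mu]_(x in I01) (f x * T a (h_ n) x) -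
   \int[mu]_(x in I01) (f x * T b (h_ n) x)) =
   (fun n => - \int[mu]_(x in I01) (g x * plateau a b (h_ n) x)).
  apply/funext => n.
  rewrite -(fg (plateau a b (h_ n))); last exact: plateau_test.
  have ii c := integrable_mulr_bounded fi (@tent_scaled_continuous _ c (h_ n))
  (fun x => tent_scaled_bound c x (h0 n)).
  rewrite derive1_plateau// -RintegralB//.
  by apply: eq_Rintegral => x _; rewrite -mulrBr.
have cab : (fun n => - \int[mu]_(x in I01) (g x * plateau a b (h_ n) x)) @ \oo
    --> f a - f b.
  by rewrite -E; exact: cvgB ca cb.
have gpi n := integrable_mulr_bounded gi (@plateau_continuous a b _ (h0 n))
   (plateau_bound a b (h_ n)).
(* the limit of the plateaus is the indicator of the interval *)
have subab : `]a, b] `<=` I01.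
  by move=> x /=; rewrite !in_itv /= => /andP[? ?]; apply/andP; split; lra.
have mg : measurable_fun I01 g.
  by apply/measurable_EFinP; case/integrableP : gi.
have [||||||ig _ dc] := @dominated_convergence _ _ _ mu I01 _
  (fun n x => (g x * plateau a b (h_ n) x)%:E)
  (EFin \o (g \_ `]a, b])) (fun x => `|g x|%:E).
- by [].
- by move=> n; case/integrableP : (gpi n).
- apply/measurable_EFinP; apply/measurable_restrict => //.
  by apply: measurable_funS mg => //; exact: subIsetl.
- apply: aeW => x _; apply: cvg_EFin; first exact: nearW.
  have -> : (g \_ `]a, b]) x = g x * ((a < x)%R%:R - (b < x)%R%:R).
    rewrite patchE; case: ifPn; rewrite ?inE ?notin_setE /= in_itv/=.
      by move=> /andP[-> xb]; rewrite ltNge xb subr0 mulr1.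
    move/negP; rewrite negb_and -leNgt -ltNge => /orP[xa|bx].
      by rewrite !ltNge xa (le_trans xa ab) subrr mulr0.
    by rewrite bx (le_lt_trans ab bx) subrr mulr0.
  apply: cvgMr; apply: cvgB; exact: smooth_step_scaled_cvg.
- exact: integrable_norm.
- apply: aeW => x n _; rewrite lee_fin normrM ler_piMr//; exact: plateau_bound.
have cg : (fun n => \int[mu]_(x in I01) (g x * plateau a b (h_ n) x)) @ \oo -->
   \int[mu]_(x in `]a, b]) g x.
  have -> : \int[mu]_(x in `]a, b]) g x = \int[mu]_(x in I01) (g \_ `]a, b]) x.
    by rewrite -Rintegral_mkcondr (setIidr subab).
  by apply: fine_cvg; rewrite /Rintegral fineK//; apply: integrable_fin_num.
have H := cvg_unique (@Rhausdorff R) cab (cvgN cg).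
by rewrite -[RHS]opprK -H opprB.
Qed.
End plateaus.

Section one_dimensional_H1.
Context {R : realType}.
Notation mu := (@lebesgue_measure R).
Local Notation I01 := (`]0%R, 1%R[%classic : set R).

Lemma Rintegral_cst_itvoc (a b c : R) : a <= b ->
  \int[mu]_(x in `]a, b]) c = c * (b - a).
Proof.
move=> ab; rewrite (_ : (fun=> c) = cst c)// Rintegral_cst//.
congr (_ * _); rewrite /= lebesgue_measure_itv /= lte_fin.
by move: ab; rewrite le_eqVlt => /predU1P[->|->//]; rewrite ltxx subrr.
Qed.

Lemma itvoc_sub01 (a b : R) : 0 < a -> b < 1 -> `]a, b] `<=` I01.
Proof.
move=> a0 b1 x /=; rewrite !in_itv /= => /andP[? ?]; apply/andP; split; lra.
Qed.

(** Cauchy-Schwarz, obtained by integrating the square of [g - m]. *)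
Lemma Rintegral_sqr_le (g : R -> R) (a b : R) : L2_01 g -> 0 < a -> a <= b ->
  b < 1 -> (\int[mu]_(x in `]a, b]) g x) ^+ 2 <=
           (b - a) * \int[mu]_(x in I01) (g x ^+ 2).
Proof.
move=> Lg a0 ab b1.
have sub := itvoc_sub01 a0 b1.
have gi : mu.-integrable `]a, b] (EFin \o g).
  by apply: integrableS (L2_integrable Lg) => //.
have ggi : mu.-integrable `]a, b] (EFin \o (fun x => g x ^+ 2)).
  by apply: integrableS (L2_integrable_sqr Lg) => //.
have ci c : mu.-integrable `]a, b] (EFin \o cst c).
  by apply: integrableS (integrable_cst01 c).
set G := \int[mu]_(x in `]a, b]) g x.
have quad m : 2 * m * G - m ^+ 2 * (b - a) <= \int[mu]_(x in I01) (g x ^+ 2).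
  rewrite -[leLHS](_ : \int[mu]_(x in `]a, b]) (2 * m * g x - m ^+ 2) = _); last first.
    rewrite RintegralB//; [| |exact: ci].
      by rewrite RintegralZl// Rintegral_cst_itvoc.
    exact: integrable_mulr_cst.
  apply: (@le_trans _ _ (\int[mu]_(x in `]a, b]) (g x ^+ 2))).
    apply: le_Rintegral => //.
      by apply: integrable_subr => //; [exact: integrable_mulr_cst|exact: ci].
    by move=> x _; have := sqr_ge0 (g x - m); rewrite !expr2; nra.
  rewrite /Rintegral fine_le//.
  - exact: integrable_fin_num.
  - by apply: integrable_fin_num => //; exact: L2_integrable_sqr.
  - apply: ge0_subset_integral => //.
      by case/integrableP : (L2_integrable_sqr Lg).
    by move=> x _; rewrite lee_fin sqr_ge0.
have [ab'|ba] := ltP a b; last first.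
  rewrite /G set_itv_ge ?bnd_simp -?leNgt// Rintegral_set0 expr0n mulr_ge0//.
    by rewrite subr_ge0.
  by apply: Rintegral_ge0 => x _; exact: sqr_ge0.
(* the best choice of m is the mean value of g *)
have := quad (G / (b - a)).
have ba : 0 < b - a by rewrite subr_gt0.
have -> : 2 * (G / (b - a)) * G - (G / (b - a)) ^+ 2 * (b - a) = G ^+ 2 / (b - a).
  by field; rewrite gt_eqF.
by rewrite ler_pdivrMr// mulrC.
Qed.

Lemma wderivP (f : R -> R) : H1_01 f ->
  L2_01 (wderiv_01 f) /\ weak_derivative_01 f (wderiv_01 f).
Proof.
move=> [_ [g [Lg wg]]]; rewrite /wderiv_01; case: xgetP => [h -> //|].
by move=> /(_ g) [].
Qed.

Lemma H1_difference_interior (f : R -> R) (a b : R) : H1_01 f -> 0 < a -> a <= b ->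
  b < 1 -> {for a, continuous f} -> {for b, continuous f} ->
  (f b - f a) ^+ 2 <=
  (b - a) * \int[mu]_(x in I01) (wderiv_01 f x ^+ 2).
Proof.
move=> Hf a0 ab b1 fa fb; have [Lg wg] := wderivP Hf.
have [Lf _] := Hf.
rewrite (weak_derivative_FTC (L2_integrable Lf) (L2_integrable Lg) wg a0 ab b1)//.
exact: Rintegral_sqr_le.
Qed.

(** Both points are moved towards 1/2, where the estimate inside the open
interval applies; continuity up to the end points lets the shift tend to 0. *)
Lemma H1_difference (f : R -> R) (a b : R) : H1_01 f ->
  {within `[0, 1], continuous f} -> 0 <= a -> a <= b -> b <= 1 ->
  (f b - f a) ^+ 2 <=
  (b - a) * \int[mu]_(x in I01) (wderiv_01 f x ^+ 2).
Proof.
move=> Hf cf a0 ab b1.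
set D := \int[mu]_(x in I01) _.
have D0 : 0 <= D by apply: Rintegral_ge0 => x _; rewrite sqr_ge0.
pose t_ (n : nat) : R := n.+2%:R^-1.
have t0 n : 0 < t_ n < 1.
  by rewrite /t_ invr_gt0 ltr0n /= invf_lt1// ltr1n.
pose s_ x n := (1 - t_ n) * x + t_ n / 2.
have s01 x n : 0 <= x <= 1 -> 0 < s_ x n < 1.
  by move=> /andP[? ?]; have /andP[? ?] := t0 n; rewrite /s_; nra.
have tcv : t_ @ \oo --> 0.
  by have := @cvg_harmonic R; rewrite -cvg_shiftS.
have scv x : s_ x @ \oo --> x.
  rewrite -[X in _ --> X](_ : (1 - 0) * x + 0 / 2 = x); last by ring.
  apply: cvgD; apply: cvgMl => //.
  by apply: cvgB => //; exact: cvg_cst.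
have fcv x : 0 <= x <= 1 -> f (s_ x n) @[n --> \oo] --> f x.
  move=> x01; move/subspace_continuousP : cf => /(_ x).
  rewrite /= in_itv /= => /(_ x01).
  apply: (@cvg_comp _ _ _ (s_ x) f _ (within `[0, 1] (nbhs x))).
  move=> A wA.
  have : \forall n \near \oo, `[0, 1]%classic (s_ x n) -> A (s_ x n) by exact: (scv x _ wA).
  apply: filterS => n; apply.
  by have /andP[? ?] := s01 x n x01; rewrite /= in_itv /= !ltW.
have fint x : 0 < x < 1 -> {for x, continuous f}.
  by have [//|+ _ _] := (continuous_within_itvP f (@ltr01 R)).1; apply.
have a01 : 0 <= a <= 1 by apply/andP; split; lra.
have b01 : 0 <= b <= 1 by apply/andP; split; lra.
have H n : (f (s_ b n) - f (s_ a n)) ^+ 2 <= (b - a) * D.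
  have /andP[sa0 sa1] := s01 a n a01; have /andP[sb0 sb1] := s01 b n b01.
  have /andP[? ?] := t0 n.
  have sab : s_ a n <= s_ b n by rewrite /s_; nra.
  apply: le_trans (H1_difference_interior Hf sa0 sab sb1 _ _) _.
  - by apply: fint; rewrite sa0.
  - by apply: fint; rewrite sb0.
  - by rewrite ler_wpM2r// /s_; nra.
have lim : (f (s_ b n) - f (s_ a n)) ^+ 2 @[n --> \oo] --> (f b - f a) ^+ 2.
  by rewrite expr2; under eq_fun do rewrite expr2; apply: cvgM; apply: cvgB; exact: fcv.
rewrite -(cvg_lim (@Rhausdorff R) lim); apply: limr_le; first exact: cvgP lim.
exact: nearW.
Qed.

(** The weak derivative [g] is an arbitrary choice, so it has to be identified
almost everywhere. All integrals of [g - k1] over subintervals vanish, hence its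
primitive is constant, and Lebesgue differentiation gives [g = k1]. *)
Lemma sqr_wderiv_affine (f : R -> R) (k0 k1 : R) : H1_01 f ->
  (forall t, 0 < t < 1 -> f t = k0 + k1 * t) ->
  (\int[mu]_(x in I01) ((wderiv_01 f x) ^+ 2)%:E = (k1 ^+ 2)%:E)%E.
Proof.
move=> Hf ft; have [Lg wg] := wderivP Hf; have [Lf _] := Hf.
set g := wderiv_01 f.
have ctn a : 0 < a < 1 -> {for a, continuous f}.
  move=> a01; have : (fun t => k0 + k1 * t) @ a --> f a.
    rewrite ft//; apply: cvgD; first exact: cvg_cst.
    by apply: cvgMr; exact: cvg_id.
  apply: cvg_trans; apply: near_eq_cvg.
  near=> t; rewrite ft//; near: t.
  by apply: filterS (near_in_itvoo a01) => t; rewrite in_itv.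
have int0 : forall a b, 0 < a -> a <= b -> b < 1 ->
    \int[mu]_(x in `]a, b]) (g x - k1) = 0.
  move=> a b a0 ab b1; rewrite RintegralB//.
  - rewrite -(weak_derivative_FTC (L2_integrable Lf) (L2_integrable Lg) wg a0 ab b1).
    + rewrite Rintegral_cst_itvoc// !ft; [ring|..]; apply/andP; split; lra.
    + by apply: ctn; apply/andP; split; lra.
    + by apply: ctn; apply/andP; split; lra.
  - by apply: integrableS (L2_integrable Lg) => //; exact: itvoc_sub01.
  - by apply: integrableS (integrable_cst01 k1) => //; exact: itvoc_sub01.
pose h := (fun x => g x - k1) \_ I01.
have hi : mu.-integrable setT (EFin \o h).
  rewrite /h -restrict_EFin; apply: (integrable_mkcond _ _).1 => //.
  apply: integrable_subr => //; [exact: L2_integrable|exact: integrable_cst01].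
pose F x := \int[mu]_(t in [set` `]-oo, x]]) h t.
have FF : forall a b, 0 < a -> a <= b -> b < 1 -> F b = F a.
  move=> a b a0 ab b1; apply/eqP; rewrite -subr_eq0.
  rewrite /F Rintegral_itvB ?bnd_simp//; last first.
    by apply: integrableS hi.
  apply/eqP; rewrite -[RHS](int0 _ _ a0 ab b1).
  apply: eq_Rintegral => x /set_mem /(itvoc_sub01 a0 b1) xI.
  by rewrite /h patchE mem_set.
have F0 x : 0 < x < 1 -> derive1 F x = 0.
  move=> x01; rewrite derive1E -[RHS](derive_cst (F x) x 1).
  apply: near_eq_derive.
  near=> t; have t01 : 0 < t < 1.
    near: t.
    by apply: filterS (near_in_itvoo x01) => t; rewrite in_itv.
  have /andP[x0 x1] := x01; have /andP[t0 t1] := t01.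
  by have [tx|xt] := leP t x; [exact/esym/FF|apply: FF => //; exact: ltW].
have hiy y : mu.-integrable `]-oo, y] (EFin \o h) by exact: integrableS hi.
have aeF := FTC1Ny hiy (open_integrable_locally openT hi).
have aeg : ae_eq mu I01 (EFin \o (fun x => g x ^+ 2)) (EFin \o cst (k1 ^+ 2)).
  move: aeF; apply: filterS; first exact: (ae_filter_ringOfSetsType mu).
  move=> x [_ Fx]; rewrite /= in_itv /= => x01.
  move: Fx; rewrite -/(F) F0// /h patchE mem_set /=; last by rewrite in_itv.
  by move=> /esym/eqP; rewrite subr_eq0 => /eqP ->.
have -> : (\int[mu]_(x in I01) (g x ^+ 2)%:E = \int[mu]_(x in I01) cst (k1 ^+ 2)%:E x)%E.
  apply: ae_eq_integral aeg => //.
    by case/integrableP : (L2_integrable_sqr Lg).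
  exact/measurable_EFinP.
rewrite integral_cst//= lebesgue_measure_itv /= lte_fin ltr01.
by rewrite oppr0 adde0 mule1.
Unshelve. all: by end_near.
Qed.

(** The weak derivative is found by integration by parts on the closed interval,
after replacing [f], prescribed on the open interval only, by the affine
function. *)
Lemma H1_affine (f : R -> R) (k0 k1 : R) :
  (forall t, 0 < t < 1 -> f t = k0 + k1 * t) -> H1_01 f.
Proof.
move=> ft.
have cont_aff : continuous (fun t : R => k0 + k1 * t).
  by move=> t; apply: cvgD; [exact: cvg_cst|apply: cvgMr; exact: cvg_id].
have L2_cont (h : R -> R) : continuous h -> L2_01 h.
  move=> hc; split.
    by apply: measurable_funTS; apply: continuous_measurable_fun.
  have : mu.-integrable I01 (EFin \o (fun x => h x ^+ 2)).
    apply: integrable_cont01.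
    rewrite (_ : (fun x => h x ^+ 2) = (fun x => h x * h x)).
      by move=> x; apply: cvgM; exact: hc.
    by apply/funext => x; rewrite expr2.
  by move=> /integrableP[_]; under eq_integral do rewrite gee0_abs ?lee_fin ?sqr_ge0//.
split.
  have [m foo] := L2_cont _ cont_aff; split.
    apply: eq_measurable_fun m => x /set_mem; rewrite /= in_itv /= => x01.
    by rewrite ft.
  have -> : (\int[mu]_(x in I01) (f x ^+ 2)%:E =
             \int[mu]_(x in I01) ((k0 + k1 * x) ^+ 2)%:E)%E => //.
  apply: eq_integral => x /set_mem.
  by rewrite /= in_itv /= => x01; rewrite ft.
exists (cst k1); split; first by apply: L2_cont; exact: cst_continuous.
move=> phi [dphi cphi [a [b [a0 b1 sub]]]].
have phi0 x : x <= 0 \/ 1 <= x -> phi x = 0.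
  move=> x01; apply/eqP; apply: contrapT => /negP x0.
  by have := sub _ x0; rewrite /= in_itv /= => /andP[? ?]; case: x01 => ?; lra.
have -> : \int[mu]_(x in I01) (f x * derive1 phi x) =
          \int[mu]_(x in I01) ((k0 + k1 * x) * derive1 phi x).
  apply: eq_Rintegral; move=> x /set_mem; rewrite /= in_itv /= => x01; by rewrite ft.
have I01cc (h : R -> R) : continuous h ->
    \int[mu]_(x in I01) h x = \int[mu]_(x in `[0, 1]) h x.
  move=> hc.
  have hi : mu.-integrable `[0, 1] (EFin \o h).
    apply: continuous_compact_integrable; first exact: segment_compact.
    exact/continuous_subspaceT.
  rewrite -Rintegral_itv_obnd_cbnd; last first.
    apply: integrableS hi => //; exact: subset_itv_oc_cc.
  rewrite -Rintegral_itv_bndo_bndc//.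
  apply: integrableS hi => //; exact: subset_itv_oo_cc.
have phic : continuous phi.
  by move=> x; apply: differentiable_continuous; apply/derivable1_diffP; exact: dphi.
have LR (h : R -> R) : (forall x, derivable h x 1) -> continuous h ->
   derivable_oo_LRcontinuous h 0 1.
  move=> dh hc; split; [by move=> x _; exact: dh|exact/cvg_at_right_filter/hc|
    exact/cvg_at_left_filter/hc].
have daff (x : R) : is_derive x 1 (fun t : R => k0 + k1 * t) k1.
  apply: (@is_derive_quadratic _ _ _ _ 0) => y.
  rewrite (_ : _ - _ - _ = 0); last ring.
  by rewrite normr0 mul0r.
rewrite !I01cc; last 2 first.
- by move=> x; apply: cvgM; [exact: cst_continuous|exact: phic].
- by move=> x; apply: cvgM; [exact: cont_aff|exact: cphi].
have LRaff : derivable_oo_LRcontinuous (fun t : R => k0 + k1 * t) 0 1.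
  apply: LR; last exact: cont_aff.
  by move=> x; exact: (@ex_derive _ _ _ _ _ _ _ (daff x)).
have Daff : {in `]0, 1[, derive1 (fun t : R => k0 + k1 * t) =1 cst k1}.
  by move=> x _; rewrite derive1E (@derive_val _ _ _ _ _ _ _ (daff x)).
have Ccst : {within `[0, 1], continuous (cst k1 : R -> R)}.
  by apply: continuous_subspaceT; exact: cst_continuous.
have Cphi : {within `[0, 1], continuous (derive1 phi)}.
  exact: continuous_subspaceT.
have Dphi : {in `]0, 1[, derive1 phi =1 derive1 phi} by [].
have -> := Rintegration_by_parts ltr01 Ccst LRaff Daff Cphi (LR _ dphi phic) Dphi.
rewrite (phi0 0) ?(phi0 1); last 2 first.
- by right.
- by left.
by rewrite !mulr0 subrr sub0r.
Qed.
End one_dimensional_H1.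

(** * Barycentric coordinates *)

Section I3.
(** Indices are named relatively to a given one, by the cyclic successor and
predecessor, so that one case analysis covers all the symmetries. *)
Lemma ord3_cases (i j : 'I_3) : [\/ j = i, j = ordS i | j = ord_pred i].
Proof.
suff : [|| j == i, j == ordS i | j == ord_pred i].
  by case/or3P => /eqP ->; [constructor 1|constructor 2|constructor 3].
by case: i j => [[|[|[|//]]] hi] [[|[|[|//]]] hj].
Qed.

Lemma ordS2 (i : 'I_3) : ordS (ordS i) = ord_pred i.
Proof. by apply/eqP; case: i => [[|[|[|//]]] hi]. Qed.
Lemma ord_pred2 (i : 'I_3) : ord_pred (ord_pred i) = ordS i.
Proof. by apply/eqP; case: i => [[|[|[|//]]] hi]. Qed.
Lemma ordS_neq (i : 'I_3) : (ordS i == i) = false.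
Proof. by apply/negP; case: i => [[|[|[|//]]] hi]. Qed.
Lemma ord_pred_neq (i : 'I_3) : (ord_pred i == i) = false.
Proof. by apply/negP; case: i => [[|[|[|//]]] hi]. Qed.
Lemma ord_pred_ordS_neq (i : 'I_3) : (ord_pred i == ordS i) = false.
Proof. by apply/negP; case: i => [[|[|[|//]]] hi]. Qed.
Definition ord3E := (ordS2, ord_pred2, ordSK, ord_predK, ordS_neq, ord_pred_neq, ord_pred_ordS_neq,
  (fun i : 'I_3 => etrans (eq_sym i (ordS i)) (ordS_neq i)),
  (fun i : 'I_3 => etrans (eq_sym i (ord_pred i)) (ord_pred_neq i)),
  (fun i : 'I_3 => etrans (eq_sym (ordS i) (ord_pred i)) (ord_pred_ordS_neq i))).

Lemma sum_ord3 (V : nmodType) (F : 'I_3 -> V) (i : 'I_3) :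
  \sum_(j < 3) F j = F i + F (ordS i) + F (ord_pred i).
Proof.
rewrite (bigD1 i)//= (bigD1 (ordS i)) ?ord3E//= (bigD1 (ord_pred i)) ?ord3E//=.
rewrite big1 ?addr0 ?addrA// => j /andP[/andP[ji jS] jp].
by have [jE|jE|jE] := ord3_cases i j; rewrite jE eqxx in ji jS jp.
Qed.
End I3.

Section bary.
Context {R : realType} (p : 'I_3 -> 'rV[R]_2).

Definition centroid : 'rV[R]_2 := 3^-1 *: \sum_(i < 3) p i.

(** For an equilateral triangle of side 1, the vectors from the centroid to the
vertices have square length 1/3 and pairwise inner products -1/6; the factor 2
then makes these affine functions the barycentric coordinates. *)
Definition bary (x : 'rV[R]_2) (i : 'I_3) : R :=
  3^-1 + 2 * \sum_(k < 2) (x 0 k - centroid 0 k) * (p i 0 k - centroid 0 k).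

Lemma bary_sum x : \sum_(i < 3) bary x i = 1.
Proof.
rewrite (sum_ord3 _ ord0) /bary !big_ord_recl !big_ord0 /centroid !mxE !summxE.
by rewrite !(sum_ord3 _ ord0); field.
Qed.

Lemma bary_affine x y (s t : R) i : s + t = 1 ->
  bary (s *: x + t *: y) i = s * bary x i + t * bary y i.
Proof.
move=> st; have -> : t = 1 - s by rewrite -st addrC addKr.
rewrite /bary !big_ord_recl !big_ord0 !mxE; by field.
Qed.

Lemma bary_p (hp : unit_equilateral p) i j : bary (p j) i = (i == j)%:R.
Proof.
have H a b : a != b -> (p a 0 0 - p b 0 0) ^+ 2 + (p a 0 1 - p b 0 1) ^+ 2 = 1.
  move=> ab; have := hp a b ab; rewrite /edist => /(congr1 (fun x => x ^+ 2)).
  rewrite sqr_sqrtr; last by apply: sumr_ge0 => k _; exact: sqr_ge0.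
  by rewrite expr1n !big_ord_recl big_ord0 addr0 => <-; congr (_ + (p a 0 _ - p b 0 _) ^+ 2); exact/val_inj.
have h1 := H i (ordS i). have h2 := H i (ord_pred i).
have h3 := H (ordS i) (ord_pred i).
rewrite !ord3E/= in h1 h2 h3.
have {}h1 := h1 isT; have {}h2 := h2 isT; have {}h3 := h3 isT.
rewrite /bary !big_ord_recl !big_ord0 /centroid !mxE !summxE.
have -> : lift ord0 ord0 = 1 :> 'I_2 by exact/val_inj.
rewrite !(sum_ord3 _ i).
have [->|->|->] := ord3_cases i j; rewrite ?eqxx ?ord3E /=; lra.
Qed.

Lemma bary_Gmap alpha i j x : unit_equilateral p ->
  bary (Gmap p alpha i x) j =
  (1 - alpha) / 2 * bary x j + (1 + alpha) / 2 * (j == i)%:R.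
Proof.
move=> hp; rewrite /Gmap scalerBr -addrA -[X in _ + (_ + X)]scale1r -scaleNr -scalerDl.
rewrite bary_affine; last by field.
by rewrite bary_p//; congr (_ + _ * _); field.
Qed.

Lemma bary_continuous i : continuous (bary ^~ i).
Proof.
have -> : bary ^~ i = fun x => 3^-1 + 2 *
  ((x 0 0 - centroid 0 0) * (p i 0 0 - centroid 0 0) +
   (x 0 1 - centroid 0 1) * (p i 0 1 - centroid 0 1)).
  apply/funext => x; rewrite /bary !big_ord_recl big_ord0 addr0.
  by have -> : lift ord0 ord0 = 1 :> 'I_2 by exact/val_inj.
have c k x : {for x, continuous (fun x : 'rV[R]_2 =>
    (x 0 k - centroid 0 k) * (p i 0 k - centroid 0 k))}.
  have := @coord_continuous R 1 2 0 k x => ck.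
  apply: (@cvgMr_tmp _ _ (nbhs x)).
  apply: (@cvgB _ _ _ (nbhs x) _ (fun x : 'rV[R]_2 => x 0 k) (cst (centroid 0 k))); [exact: ck|exact: cvg_cst].
move=> x; have F : Filter (nbhs (x : 'rV[R]_2)) by exact: nbhs_filter.
have H := @cvgD _ _ _ (nbhs x) _ _ _ _ _ (c 0 x) (c 1 x).
have H2 := @cvgMl_tmp _ _ (nbhs x) _ _ 2 _ (H F).
exact: (@cvgD R R _ (nbhs x) F (cst 3^-1) _ _ _ (cvg_cst _) (H2 F)).

Qed.

End bary.

(** * Geometry of the attractor *)

Section attractor.
Context {R : realType} (p : 'I_3 -> 'rV[R]_2) (alpha : R) (K : set 'rV[R]_2).
Context (hp : unit_equilateral p) (ha : 0 < alpha < 1)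
  (hK : hanoi_attractor p alpha K).
Local Notation G := (Gmap p alpha).
Local Notation Gw := (Gword p alpha).
Local Notation xi := (edge_param p alpha).

Lemma attractor_compact : compact K. Proof. by case: hK. Qed.

Lemma attractor_cases x : K x ->
  (exists i y, K y /\ x = G i y) \/
  (exists i t, 0 < t < 1 /\ x = xi [::] i t).
Proof.
case: hK => _ _ {1}->; case=> -[i _ [y]].
  by move=> Ky <-; left; exists i, y.
by rewrite /= in_itv /= => t01 <-; right; exists i, y.
Qed.

Lemma attractor_Gmap i y : K y -> K (G i y).
Proof. by case: hK => _ _ -> Ky; left; exists i => //; exists y => //; case: hK => _ _ ->. Qed.

Lemma attractor_first_edge i t : 0 < t < 1 -> K (xi [::] i t).
Proof. by case: hK => _ _ -> t01; right; exists i => //; exists t. Qed.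

Lemma attractor_Gword w y : K y -> K (Gw w y).
Proof. by elim: w => //= i w IH /IH; exact: attractor_Gmap. Qed.

Lemma Gword_cat w v y : Gw (w ++ v) y = Gw w (Gw v y).
Proof. by rewrite /Gword foldr_cat. Qed.

Lemma Gword_rcons w i y : Gw (rcons w i) y = Gw w (G i y).
Proof. by rewrite /Gword foldr_rcons. Qed.

Lemma edge_param_cat w v i t : xi (w ++ v) i t = Gw w (xi v i t).
Proof. by rewrite /edge_param Gword_cat. Qed.

Lemma attractor_edge w i t : 0 < t < 1 -> K (xi w i t).
Proof. by move=> t01; rewrite -[w]cats0 edge_param_cat; apply/attractor_Gword/attractor_first_edge. Qed.

Lemma Gmap_fix i : G i (p i) = p i.
Proof. by rewrite /Gmap subrr scaler0 add0r. Qed.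

Lemma iter_Gmap i n x : iter n (G i) x = ((1 - alpha) / 2) ^+ n *: (x - p i) + p i.
Proof.
elim: n => [|n IH]; first by rewrite expr0 scale1r subrK.
by rewrite iterS IH /Gmap addrK scalerA -exprS.
Qed.

(** [p i] is the limit of the iterates of the contraction [Gmap p alpha i] at a
point of the closed set [K]. *)
Lemma attractor_vertex i : K (p i).
Proof.
have [[x0 Kx0] cK _] := hK.
have clK : closed K by apply: compact_closed => //; exact: norm_hausdorff.
have Kn n : K (iter n (G i) x0) by elim: n => // n; exact: attractor_Gmap.
have cv : (fun n => iter n (G i) x0) @ \oo --> p i.
  have E : (fun n => ((1 - alpha) / 2) ^+ n *: (x0 - p i) + p i) @ \oo -->
      0 *: (x0 - p i) + p i.
    apply: cvgD; last exact: cvg_cst.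
    apply: cvgZr_tmp; apply: cvg_expr.
    by rewrite ger0_norm; have /andP[? ?] := ha; lra.
  rewrite scale0r add0r in E; apply: cvg_trans E.
  by apply: near_eq_cvg; apply: nearW => n; rewrite iter_Gmap.
by apply: (closed_cvg K clK _ _ cv); exact: nearW.
Qed.

Lemma edge_param0 w i : xi w i 0 = Gw w (G (ordS i) (p (ord_pred i))).
Proof. by rewrite /edge_param subr0 scale1r scale0r addr0. Qed.

Lemma edge_param1 w i : xi w i 1 = Gw w (G (ord_pred i) (p (ordS i))).
Proof. by rewrite /edge_param subrr scale1r scale0r add0r. Qed.

Lemma attractor_closed_edge w i t : 0 <= t <= 1 -> K (xi w i t).
Proof.
move=> /andP[t0 t1].
move: t0; rewrite le_eqVlt => /predU1P[<-|t0]; first by rewrite edge_param0; apply/attractor_Gword/attractor_Gmap/attractor_vertex.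
move: t1; rewrite le_eqVlt => /predU1P[->|t1]; first by rewrite edge_param1; apply/attractor_Gword/attractor_Gmap/attractor_vertex.
by apply: attractor_edge; rewrite t0.
Qed.

Lemma bary_edge_opposite i t : bary p (xi [::] i t) i = 0.
Proof.
rewrite /edge_param /= bary_affine; last by rewrite subrK.
by rewrite !bary_Gmap// !bary_p// !ord3E !mulr0 !addr0 !mulr0 addr0.
Qed.

Lemma bary_edge_succ i t : bary p (xi [::] i t) (ordS i) =
  (1 - t) * ((1 + alpha) / 2) + t * ((1 - alpha) / 2).
Proof.
rewrite /edge_param /= bary_affine; last by rewrite subrK.
by rewrite !bary_Gmap// !bary_p// !ord3E !eqxx !mulr0 !mulr1 addr0 add0r.
Qed.

Lemma bary_edge_pred i t : bary p (xi [::] i t) (ord_pred i) =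
  (1 - t) * ((1 - alpha) / 2) + t * ((1 + alpha) / 2).
Proof.
rewrite /edge_param /= bary_affine; last by rewrite subrK.
by rewrite !bary_Gmap// !bary_p// !ord3E !eqxx !mulr0 !mulr1 addr0 add0r.
Qed.

(** At a point of [K] where the coordinate is minimal, self-similarity writes the
minimum as another value of the coordinate, contracted towards 0 or 1; this is
impossible for a negative minimum. *)
Lemma bary_ge0 x i : K x -> 0 <= bary p x i.
Proof.
have [K0 cK _] := hK; have /andP[a0 a1] := ha.
have [z /set_mem Kz zmin] : exists2 z, z \in K & forall t, t \in K -> bary p z i <= bary p t i.
  apply: compact_EVT_min => //; apply: continuous_subspaceT; exact: bary_continuous.
suff z0 : 0 <= bary p z i.
  by move=> Kx; apply: le_trans z0 (zmin _ _); exact: mem_set.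
have [[j [y [Ky zE]]]|[j [t [/andP[? ?] zE]]]] := attractor_cases Kz.
  have := zmin y (mem_set Ky).
  rewrite {1 2}zE bary_Gmap//.
  have : 0 <= (1 + alpha) / 2 * ((i == j)%:R : R).
    by rewrite mulr_ge0// ?ler0n//; lra.
  set e := (X in 0 <= X) => e0 ye; have [y0|y0] := leP 0 (bary p y i).
    by rewrite addr_ge0// mulr_ge0//; lra.
  (* a negative value would be strictly smaller than its contraction *)
  have : (1 + alpha) * bary p y i < 0 by rewrite pmulr_rlt0//; lra.
  by move: e0 ye; rewrite /e; lra.
rewrite zE; have [->|->|->] := ord3_cases j i; rewrite ?bary_edge_opposite// ?bary_edge_succ ?bary_edge_pred; nra.
Qed.

Lemma bary_le1 x i : K x -> bary p x i <= 1.
Proof.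
move=> Kx; have := bary_sum p x; rewrite (sum_ord3 _ i).
have := bary_ge0 (ordS i) Kx; have := bary_ge0 (ord_pred i) Kx; lra.
Qed.

End attractor.

(** * Functions given by a tree of vertex values *)

Section continuity.
Context {R : realType} {T : topologicalType}.
Implicit Types f g : T -> R.

Lemma continuous_add f g : continuous f -> continuous g ->
  continuous (fun x => f x + g x).
Proof. by move=> cf cg x; apply: (@cvgD R R T (nbhs x)) => //; [exact: cf|exact: cg]. Qed.

Lemma continuous_mul f g : continuous f -> continuous g ->
  continuous (fun x => f x * g x).
Proof. by move=> cf cg x; apply: (@cvgM R T (nbhs x)) => //; [exact: cf|exact: cg]. Qed.

Lemma continuous_sum (I : Type) (r : seq I) (F : I -> T -> R) :
  (forall i, continuous (F i)) -> continuous (fun x => \sum_(i <- r) F i x).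
Proof.
move=> cF; elim: r => [|i r IH].
  by under eq_fun do rewrite big_nil; exact: cst_continuous.
by under eq_fun do rewrite big_cons; exact: continuous_add.
Qed.
Lemma continuous_min2 f g : continuous f -> continuous g ->
  continuous (fun x => Num.min (f x) (g x)).
Proof. by move=> cf cg x; exact: (continuous_min (cf x) (cg x)). Qed.

Lemma continuous_max2 f g : continuous f -> continuous g ->
  continuous (fun x => Num.max (f x) (g x)).
Proof. by move=> cf cg x; exact: (continuous_max (cf x) (cg x)). Qed.
End continuity.

Section tree.
Context {R : realType}.
Implicit Types (V : seq 'I_3 -> 'I_3 -> R) (b : 'I_3 -> R).

Definition clamp (x : R) : R := Num.min 1 (Num.max 0 x).

(** On [K]: 1 on the cell [i], 0 on the two other cells, affine on the edges. *)
Definition cell_weight (alpha : R) b (i : 'I_3) : R :=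
  clamp ((b i - (1 - alpha) / 2) / alpha).

(** The coordinates pulled back by the [i]-th contraction, clamped so that the
whole edge leaving the cell [i] is sent to the vertex at which it starts. *)
Definition cell_coord (alpha : R) (i : 'I_3) b (j : 'I_3) : R :=
  let c := (1 - alpha) / 2 in
  if j == i then Num.max 0 ((b i - (1 - c)) / c) else Num.min 1 (b j / c).

(** A tree assigns to a word [w] the values of a function at the vertices of the
cell [w]. Its [n]-th approximation is affine on the part of [K] in a
cell of level [n] and on the edges outside these cells. The clamped formula is
continuous on the whole plane, which gives continuity on [K] without describing
[K] near its points. *)
Fixpoint tree_approx (alpha : R) n V b : R :=
  if n is n.+1 then
    \sum_(i < 3) cell_weight alpha b i *
      tree_approx alpha n (fun w => V (i :: w)) (cell_coord alpha i b)
  else \sum_(j < 3) b j * V [::] j.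

Lemma tree_approx_continuous (T : topologicalType) alpha n V
    (beta : T -> 'I_3 -> R) : (forall j, continuous (beta ^~ j)) ->
  continuous (fun x => tree_approx alpha n V (beta x)).
Proof.
elim: n V beta => [|n IH] V beta cb /=; apply: continuous_sum => i.
  by apply: continuous_mul; [exact: cb|exact: cst_continuous].
have caff (j : 'I_3) (d e : R) : continuous (fun x => (beta x j - d) / e).
  by apply: continuous_mul; [apply: continuous_add; [exact: cb|]|]; exact: cst_continuous.
apply: continuous_mul.
  apply: continuous_min2; first exact: cst_continuous.
  by apply: continuous_max2; [exact: cst_continuous|exact: caff].
apply: (IH (fun w => V (i :: w)) (fun x => cell_coord alpha i (beta x))) => j.
rewrite /cell_coord; case: (j == i).
  by apply: continuous_max2; [exact: cst_continuous|exact: caff].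
apply: continuous_min2; first exact: cst_continuous.
by apply: continuous_mul; [exact: cb|exact: cst_continuous].
Qed.

Definition compat V := forall w i, V (rcons w i) i = V w i.

(** 3/5 is the supremum of the ratios [r] of matching pairs. *)
Definition geometric_osc (C : R) V :=
  forall w i j k, `|V (rcons w i) j - V w k| <= C * (3 / 5) ^+ size w.

Lemma compat_sub V i : compat V -> compat (fun w => V (i :: w)).
Proof. by move=> cV w j; rewrite -rcons_cons cV. Qed.

Lemma geometric_osc_sub C V i : geometric_osc C V ->
  geometric_osc (C * (3 / 5)) (fun w => V (i :: w)).
Proof. by move=> oV w a j k; rewrite -rcons_cons -mulrA -exprS; exact: oV. Qed.

Lemma convex_dist (a A : 'I_3 -> R) (B C : R) : (forall i, 0 <= a i) ->
  \sum_(i < 3) a i = 1 -> (forall i, `|A i - B| <= C) ->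
  `|\sum_(i < 3) a i * A i - B| <= C.
Proof.
move=> a0 a1 AB; rewrite -[B]mul1r -a1 mulr_suml -sumrB.
apply: le_trans (ler_norm_sum _ _ _) _.
rewrite -[leRHS]mul1r -a1 mulr_suml; apply: ler_sum => i _.
by rewrite -mulrBr normrM ger0_norm// ler_wpM2l.
Qed.

End tree.

Section tree_on_attractor.
Context {R : realType} (p : 'I_3 -> 'rV[R]_2) (alpha : R) (K : set 'rV[R]_2).
Context (hp : unit_equilateral p) (ha : 0 < alpha < 1)
  (hK : hanoi_attractor p alpha K).
Local Notation G := (Gmap p alpha).
Local Notation xi := (edge_param p alpha).
Local Notation U := (tree_approx alpha).
Implicit Types V : seq 'I_3 -> 'I_3 -> R.

Lemma clamp0 (x : R) : x <= 0 -> clamp x = 0.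
Proof. by move=> x0; rewrite /clamp (max_idPl x0) (min_idPr ler01). Qed.
Lemma clamp1 (x : R) : 1 <= x -> clamp x = 1.
Proof. by move=> x1; rewrite /clamp max_r ?(le_trans ler01)// min_l. Qed.
Lemma clamp_id (x : R) : 0 <= x <= 1 -> clamp x = x.
Proof. by move=> /andP[x0 x1]; rewrite /clamp max_r// min_r. Qed.

Lemma cell_weight_Gmap i y j : K y -> cell_weight alpha (bary p (G i y)) j = (j == i)%:R.
Proof.
move=> Ky; have /andP[a0 a1] := ha; rewrite /cell_weight bary_Gmap//.
have y0 := bary_ge0 hp ha hK j Ky; have y1 := bary_le1 hp ha hK j Ky.
case: eqP => _; rewrite ?mulr1 ?mulr0.
  by rewrite clamp1// ler_pdivlMr//; nra.
by rewrite clamp0// pmulr_lle0 ?invr_gt0//; nra.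
Qed.

Lemma cell_coord_Gmap i y : K y -> cell_coord alpha i (bary p (G i y)) = bary p y.
Proof.
move=> Ky; have /andP[a0 a1] := ha; apply/funext => j; rewrite /cell_coord !bary_Gmap// eqxx.
have y0 := bary_ge0 hp ha hK j Ky; have y1 := bary_le1 hp ha hK j Ky.
case: eqP => [<-|_].
  rewrite mulr1 (_ : (_ - _) / _ = bary p y j) ?max_r//.
  by field; lra.
rewrite (_ : _ / _ = bary p y j) ?min_r//.
by rewrite mulr0 addr0; field; lra.
Qed.

Lemma tree_approx_Gmap n V i y : K y ->
  U n.+1 V (bary p (G i y)) = U n (fun w => V (i :: w)) (bary p y).
Proof.
move=> Ky /=; rewrite (sum_ord3 _ i) !cell_weight_Gmap// eqxx !ord3E cell_coord_Gmap//.
by rewrite !mul0r !addr0 mul1r.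
Qed.

Lemma tree_approx_vertex n V k : compat V -> U n V (bary p (p k)) = V [::] k.
Proof.
elim: n V => [|n IH] V cV.
  rewrite /= (sum_ord3 _ k) !bary_p// eqxx !ord3E.
  by rewrite !mul0r !addr0 mul1r.
rewrite -{1}(Gmap_fix p alpha k) tree_approx_Gmap; last exact: (attractor_vertex ha hK).
by rewrite IH; [rewrite -(cV [::] k)|exact: compat_sub].
Qed.

Lemma tree_approx_edge n V i t : compat V -> 0 <= t <= 1 ->
  U n.+1 V (bary p (xi [::] i t)) =
  (1 - t) * V [:: ordS i] (ord_pred i) + t * V [:: ord_pred i] (ordS i).
Proof.
move=> cV /andP[t0 t1]; have /andP[a0 a1] := ha.
have b0 := bary_edge_opposite alpha hp i t.
have bS := bary_edge_succ alpha hp i t; have bp := bary_edge_pred alpha hp i t.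
have w0 : cell_weight alpha (bary p (xi [::] i t)) i = 0.
  by rewrite /cell_weight b0 clamp0// pmulr_lle0 ?invr_gt0//; lra.
have wS : cell_weight alpha (bary p (xi [::] i t)) (ordS i) = 1 - t.
  rewrite /cell_weight bS -[RHS]clamp_id; last by apply/andP; split; lra.
  by congr clamp; field; lra.
have wp : cell_weight alpha (bary p (xi [::] i t)) (ord_pred i) = t.
  rewrite /cell_weight bp -[RHS]clamp_id; last by apply/andP; split; lra.
  by congr clamp; field; lra.
have cS : cell_coord alpha (ordS i) (bary p (xi [::] i t)) = bary p (p (ord_pred i)).
  apply/funext => j; rewrite bary_p// /cell_coord.
  have [->|->|->] := ord3_cases i j; rewrite ?eqxx ?ord3E.
  - by rewrite b0 mul0r min_r.
  - by rewrite bS max_l// pmulr_lle0 ?invr_gt0//; [nra|lra].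
  - by rewrite bp min_l// ler_pdivlMr; [nra|lra].
have cp : cell_coord alpha (ord_pred i) (bary p (xi [::] i t)) = bary p (p (ordS i)).
  apply/funext => j; rewrite bary_p// /cell_coord.
  have [->|->|->] := ord3_cases i j; rewrite ?eqxx ?ord3E.
  - by rewrite b0 mul0r min_r.
  - by rewrite bS min_l// ler_pdivlMr; [nra|lra].
  - by rewrite bp max_l// pmulr_lle0 ?invr_gt0//; [nra|lra].
rewrite /= (sum_ord3 _ i) w0 wS wp cS cp mul0r add0r.
by rewrite !tree_approx_vertex//; exact: compat_sub.
Qed.

(** On a cell of level [n] both approximations are convex combinations of vertex
values that are close to each other, and on the edges met before they agree. *)
Lemma tree_approx_step n V C x : compat V -> geometric_osc C V -> K x ->
  `|U n.+1 V (bary p x) - U n V (bary p x)| <= C * (3 / 5) ^+ n.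
Proof.
move=> + + Kx.
elim: n V C x Kx => [|n IH] V C x Kx cV oV.
  rewrite distrC; apply: convex_dist => [i||k].
  - exact: (bary_ge0 hp ha hK).
  - exact: bary_sum.
  - have [[i [y [Ky ->]]]|[i [t [/andP[t0 t1] ->]]]] := attractor_cases hK Kx.
      rewrite tree_approx_Gmap// distrC; apply: convex_dist => [j||j].
      + exact: (bary_ge0 hp ha hK).
      + exact: bary_sum.
      + exact: (oV [::] i j k).
    rewrite tree_approx_edge ?(ltW t0) ?(ltW t1)//= distrC expr0 mulr1.
    have o1 := oV [::] (ordS i) (ord_pred i) k.
    have o2 := oV [::] (ord_pred i) (ordS i) k.
    move: o1 o2; rewrite /= !expr0 !mulr1 !ler_norml => /andP[? ?] /andP[? ?].
    by apply/andP; split; nra.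
have [[i [y [Ky ->]]]|[i [t [/andP[t0 t1] ->]]]] := attractor_cases hK Kx.
  rewrite !tree_approx_Gmap// exprS mulrA.
  by apply: IH => //; [exact: compat_sub|exact: geometric_osc_sub].
rewrite !tree_approx_edge ?(ltW t0) ?(ltW t1)//= subrr normr0.
rewrite mulr_ge0 ?exprn_ge0 ?divr_ge0//.
by have := oV [::] i i i; rewrite expr0 mulr1; exact: le_trans.
Qed.

End tree_on_attractor.

(** Subtracting, or adding, the remaining geometric tail makes the sequence
monotone, and these two monotone sequences enclose its limit. *)
Lemma geometric_cauchy {R : realType} (a : nat -> R) (C q : R) : 0 <= q < 1 ->
  (forall n, `|a n.+1 - a n| <= C * q ^+ n) ->
  cvgn a /\ forall n, `|limn a - a n| <= C / (1 - q) * q ^+ n.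
Proof.
move=> /andP[q0 q1] H; set D := C / (1 - q).
have DC : D - D * q = C by rewrite /D; field; lra.
pose lo n := a n - D * q ^+ n; pose hi n := a n + D * q ^+ n.
have H' n : - (C * q ^+ n) <= a n.+1 - a n <= C * q ^+ n by rewrite -ler_norml.
have lo_nd : nondecreasing_seq lo.
  apply/nondecreasing_seqP => n; rewrite /lo exprS.
  by have /andP[] := H' n; rewrite -DC; lra.
have hi_ni : nonincreasing_seq hi.
  apply/nonincreasing_seqP => n; rewrite /hi exprS.
  by have /andP[] := H' n; rewrite -DC; lra.
have D0 : 0 <= D.
  rewrite divr_ge0 ?subr_ge0 ?(ltW q1)//.
  by have := H 0%N; rewrite expr0 mulr1; exact: le_trans.
have lohi m n : lo m <= hi n.
  have lh k : lo k <= hi k.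
    by have := mulr_ge0 D0 (exprn_ge0 k q0); rewrite /lo /hi; lra.
  have [mn|nm] := leqP m n; first exact: le_trans (lo_nd _ _ mn) (lh n).
  exact: le_trans (lh m) (hi_ni _ _ (ltnW nm)).
have Dq : (fun n => D * q ^+ n) @ \oo --> 0.
  rewrite -[X in _ --> X](mulr0 D); apply: cvgMr; apply: cvg_expr.
  by rewrite ger0_norm.
have clo : cvgn lo.
  apply: nondecreasing_is_cvgn => //; exists (hi 0%N) => _ [n _ <-]; exact: lohi.
have ca : a @ \oo --> limn lo.
  have := cvgD clo Dq; rewrite addr0.
  have -> : lo + (fun n => D * q ^+ n) = a by apply/funext => n; rewrite /lo /= fctE subrK.
  exact.
split; first exact: cvgP ca.
move=> n; rewrite (cvg_lim (@Rhausdorff R) ca) ler_norml.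
have l1 : lo n <= limn lo by exact: nondecreasing_cvgn_le.
have l2 : limn lo <= hi n by apply: limr_le => //; apply: nearW => m; exact: lohi.
by move: l1 l2; rewrite /lo /hi => l1 l2; apply/andP; split; lra.
Qed.

Section tree_function.
Context {R : realType} (p : 'I_3 -> 'rV[R]_2) (alpha : R) (K : set 'rV[R]_2).
Context (hp : unit_equilateral p) (ha : 0 < alpha < 1)
  (hK : hanoi_attractor p alpha K).
Local Notation Gw := (Gword p alpha).
Local Notation xi := (edge_param p alpha).
Local Notation U := (tree_approx alpha).
Context (V : seq 'I_3 -> 'I_3 -> R) (C : R) (cV : compat V)
  (oV : geometric_osc C V).

Definition tree_fun (x : 'rV[R]_2) : R := limn (fun n => U n V (bary p x)).

Lemma tree_fun_dist n x : K x ->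
  `|tree_fun x - U n V (bary p x)| <= C * (5 / 2) * (3 / 5) ^+ n.
Proof.
move=> Kx.
have q01 : 0 <= (3 / 5 : R) < 1 by apply/andP; split; lra.
have [_ /(_ n)] := geometric_cauchy q01 (fun n => tree_approx_step hp ha hK n cV oV Kx).
by rewrite (_ : C / _ = C * (5 / 2))//; field.
Qed.

Lemma tree_fun_continuous : {within K, continuous tree_fun}.
Proof.
have C0 : 0 <= C.
  by have := oV [::] ord0 ord0 ord0; rewrite expr0 mulr1; exact: le_trans.
have q0 : (fun n => C * (5 / 2) * (3 / 5 : R) ^+ n) @ \oo --> 0.
  rewrite -[X in _ --> X](mulr0 (C * (5 / 2))); apply: cvgMr; apply: cvg_expr.
  by rewrite ger0_norm; lra.
apply/subspace_continuousP => x Kx; apply/cvgrPdist_lt => e e0.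
have e3 : 0 < e / 3 by lra.
have [n _ hn] : \forall n \near \oo, C * (5 / 2) * (3 / 5 : R) ^+ n < e / 3.
  move/cvgrPdist_lt : q0 => /(_ _ e3); apply: filterS => n.
  by rewrite sub0r normrN; apply: le_lt_trans; exact: ler_norm.
have {}hn := hn n (leqnn n).
have := @tree_approx_continuous R _ alpha n V (bary p) (fun j => @bary_continuous R p j) x.
move=> /cvgrPdist_lt /(_ _ e3).
rewrite near_withinE; apply: filterS => y xy Ky.
have d1 := tree_fun_dist n Kx; have d2 := tree_fun_dist n Ky.
move: d1 d2 xy => /ler_normlP[? ?] /ler_normlP[? ?] /ltr_normlP[? ?].
rewrite /from_subspace; apply/ltr_normlP; split; lra.
Qed.

Lemma tree_approx_Gword n w y : K y ->
  U (size w + n) V (bary p (Gw w y)) = U n (fun v => V (w ++ v)) (bary p y).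
Proof.
move=> Ky; elim: w V => [//|i w IH] W.
by rewrite addSn /= -/(Gw w y) -(IH (fun v => W (i :: v))) -(tree_approx_Gmap hp ha hK)//; exact: attractor_Gword.
Qed.

Lemma lim_shift_cst (a : nat -> R) m l : (forall n, a (m + n)%N = l) -> limn a = l.
Proof.
move=> H; apply: cvg_lim => //; rewrite -(cvg_shiftn m) /=.
by under eq_fun do rewrite addnC H; exact: cvg_cst.
Qed.

Lemma compat_cat w : compat (fun v => V (w ++ v)).
Proof. by move=> v i; rewrite -rcons_cat cV. Qed.

Lemma tree_fun_vertex w k : tree_fun (Gw w (p k)) = V w k.
Proof.
apply: (@lim_shift_cst _ (size w)) => n.
rewrite tree_approx_Gword; last exact: (attractor_vertex ha hK).
by rewrite (tree_approx_vertex hp ha hK) ?cats0//; exact: compat_cat.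
Qed.

Lemma tree_fun_edge w i t : 0 <= t <= 1 -> tree_fun (xi w i t) =
  (1 - t) * V (rcons w (ordS i)) (ord_pred i) +
  t * V (rcons w (ord_pred i)) (ordS i).
Proof.
move=> t01; apply: (@lim_shift_cst _ (size w).+1) => n.
rewrite -[w in xi w]cats0 edge_param_cat addSnnS tree_approx_Gword; last exact: (attractor_closed_edge ha hK).
by rewrite (tree_approx_edge hp ha hK)// ?cats1//; exact: compat_cat.
Qed.

Lemma tree_fun_cst w l y : (forall v i, V (w ++ v) i = l) -> K y ->
  tree_fun (Gw w y) = l.
Proof.
move=> Vl Ky; apply: (@lim_shift_cst _ (size w)) => n.
rewrite tree_approx_Gword//.
pose W0 v := V (w ++ v).
have : forall v i, W0 v i = l by exact: Vl.
rewrite -/W0; elim: n W0 y Ky {Vl} => [|n IH] W {}y Ky Wl.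
  rewrite /=; under eq_bigr do rewrite Wl.
  by rewrite -mulr_suml bary_sum mul1r.
have [[i [z [Kz ->]]]|[i [t [/andP[t0 t1] ->]]]] := attractor_cases hK Ky.
  by rewrite (tree_approx_Gmap hp ha hK)//; apply: IH.
rewrite (tree_approx_edge hp ha hK) ?Wl; first by ring.
  by move=> v j; rewrite !Wl.
by rewrite (ltW t0) (ltW t1).
Qed.

End tree_function.

(** * Harmonic extension *)

Lemma big_tuple_cons (V : nmodType) m (F : seq 'I_3 -> V) :
  \sum_(w : m.+1.-tuple 'I_3) F w = \sum_(i < 3) \sum_(w : m.-tuple 'I_3) F (i :: w).
Proof.
rewrite pair_big /= (reindex (fun q : 'I_3 * m.-tuple 'I_3 => [tuple of q.1 :: q.2]))//=.
exists (fun w => (thead w, [tuple of behead w])) => [[i w] _|w _] /=.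
  by congr pair; exact/val_inj.
by rewrite -tuple_eta.
Qed.

Lemma big_tuple0 (V : nmodType) (F : seq 'I_3 -> V) :
  \sum_(w : 0.-tuple 'I_3) F w = F [::].
Proof.
rewrite (bigD1 [tuple])//= big1 ?addr0// => w /negP[]; apply/eqP; exact: tuple0.
Qed.

Section tree_sums.
Context {R : realType}.
Implicit Types (V : seq 'I_3 -> 'I_3 -> R) (a : 'I_3 -> R).

Definition vertex_form a : R := \sum_(i < 3) (a i - a (ordS i)) ^+ 2.

(** [QSigma], read on a tree. *)
Definition vertex_sum m V : R := \sum_(w : m.-tuple 'I_3) vertex_form (V w).

Definition edge_form V : R :=
  \sum_(i < 3) (V [:: ord_pred i] (ordS i) - V [:: ordS i] (ord_pred i)) ^+ 2.

Definition edge_sum m V : R :=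
  \sum_(w : m.-tuple 'I_3) edge_form (fun v => V (w ++ v)).

Lemma vertex_sum0 V : vertex_sum 0 V = vertex_form (V [::]).
Proof. exact: (big_tuple0 (fun w => vertex_form (V w))). Qed.

Lemma vertex_sumS m V :
  vertex_sum m.+1 V = \sum_(i < 3) vertex_sum m (fun w => V (i :: w)).
Proof. exact: (big_tuple_cons m (fun w => vertex_form (V w))). Qed.

Lemma edge_sum0 V : edge_sum 0 V = edge_form V.
Proof. exact: (big_tuple0 (fun w => edge_form (fun v => V (w ++ v)))). Qed.

Lemma edge_sumS m V :
  edge_sum m.+1 V = \sum_(i < 3) edge_sum m (fun w => V (i :: w)).
Proof. exact: (big_tuple_cons m (fun w => edge_form (fun v => V (w ++ v)))). Qed.

(** How the two energies evolve for a tree that is constant along the edges of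
the first [N] levels and is extended harmonically afterwards, [k] being the
level of its root. *)
Definition harmonic_from (r_ rho_ : nat -> R) k N V :=
  [/\ forall n, (N <= n)%N ->
        vertex_sum n.+1 V = 5 / 3 * r_ (k + n)%N ^+ 2 * vertex_sum n V,
      forall n, (N <= n)%N -> edge_sum n V = rho_ (k + n)%N ^+ 2 * vertex_sum n V &
      forall n, (n < N)%N -> edge_sum n V = 0].

Definition node a (W : 'I_3 -> seq 'I_3 -> 'I_3 -> R) : seq 'I_3 -> 'I_3 -> R :=
  fun w => if w is i :: v then W i v else a.

Lemma harmonic_node r_ rho_ k N a W :
  (forall i, harmonic_from r_ rho_ k.+1 N (W i)) ->
  edge_form (node a W) = 0 -> harmonic_from r_ rho_ k N.+1 (node a W).
Proof.
move=> HW e0; split=> [[//|n]|[//|n]|[|n]] Nn.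
- rewrite !vertex_sumS mulr_sumr; apply: eq_bigr => i _.
  by have [-> // _ _] := HW i; rewrite addSnnS.
- rewrite edge_sumS vertex_sumS mulr_sumr; apply: eq_bigr => i _.
  by have [_ -> // _] := HW i; rewrite addSnnS.
- by rewrite edge_sum0.
- by rewrite edge_sumS big1// => i _; have [_ _ ->] := HW i.
Qed.

Definition cst_tree (l : R) : seq 'I_3 -> 'I_3 -> R := fun _ _ => l.

Lemma vertex_sum_cst n l : vertex_sum n (cst_tree l) = 0.
Proof. by rewrite /vertex_sum big1// => w _; rewrite /vertex_form big1// => i _; rewrite subrr expr0n. Qed.

Lemma edge_sum_cst n l : edge_sum n (cst_tree l) = 0.
Proof. by rewrite /edge_sum big1// => w _; rewrite /edge_form big1// => i _; rewrite subrr expr0n. Qed.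

Lemma harmonic_cst r_ rho_ k N l : harmonic_from r_ rho_ k N (cst_tree l).
Proof. by split=> n _; rewrite ?vertex_sum_cst ?edge_sum_cst ?mulr0. Qed.

(** Values on the [i]-th subcell of the harmonic extension of [a]. On the network
made of three triangles of resistance [r] joined by edges of resistance
[1 - 5 / 3 * r], Kirchhoff's equations have this solution, linear in [r]. *)
Definition extend (r : R) a (i j : 'I_3) : R :=
  if j == i then a i else (1 - r) * a i + r / 3 * (a j + (\sum_(l < 3) a l - a i)).

Lemma extendS r a i : extend r a i (ordS i) =
  (1 - r) * a i + 2 * r / 3 * a (ordS i) + r / 3 * a (ord_pred i).
Proof. by rewrite /extend ord3E (sum_ord3 _ i); field. Qed.

Lemma extendp r a i : extend r a i (ord_pred i) =
  (1 - r) * a i + 2 * r / 3 * a (ord_pred i) + r / 3 * a (ordS i).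
Proof. by rewrite /extend ord3E (sum_ord3 _ i); field. Qed.

Lemma extend_id r a i : extend r a i i = a i.
Proof. by rewrite /extend eqxx. Qed.

Lemma vertex_form_extend r a :
  \sum_(i < 3) vertex_form (extend r a i) = 5 / 3 * r ^+ 2 * vertex_form a.
Proof.
have E i : vertex_form (extend r a i) = r ^+ 2 *
    ((2 / 3 * (a i - a (ordS i)) + 3^-1 * (a i - a (ord_pred i))) ^+ 2 +
     (3^-1 * (a (ordS i) - a (ord_pred i))) ^+ 2 +
     (2 / 3 * (a i - a (ord_pred i)) + 3^-1 * (a i - a (ordS i))) ^+ 2).
  by rewrite /vertex_form (sum_ord3 _ i) !ord3E !extendS !extendp !extend_id; field.
under eq_bigr do rewrite E.
by rewrite /vertex_form !(sum_ord3 _ ord0) !ord3E; field.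
Qed.

(** Divided by [rho], this is the share [rho] of [vertex_form a]; by
[vertex_form_extend] the triangles, divided by [r], carry the share [5 / 3 * r].
So the matching condition says that the extension preserves the energy. *)
Lemma edge_form_extend (r rho : R) a W : 5 / 3 * r + rho = 1 ->
  (forall i, W i [::] = extend r a i) ->
  edge_form (node a W) = rho ^+ 2 * vertex_form a.
Proof.
move=> m WE; have -> : rho = 1 - 5 / 3 * r by lra.
have E i : extend r a (ord_pred i) (ordS i) - extend r a (ordS i) (ord_pred i) =
    (1 - 5 / 3 * r) * (a (ord_pred i) - a (ordS i)).
  by rewrite /extend !ord3E !(sum_ord3 _ i); field.
rewrite /edge_form /node; under eq_bigr do rewrite !WE E exprMn.
by rewrite -mulr_sumr /vertex_form !(sum_ord3 _ ord0) !ord3E; congr (_ * _); ring.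
Qed.

Fixpoint harm (r_ : nat -> R) k a (w : seq 'I_3) {struct w} : 'I_3 -> R :=
  if w is i :: v then harm r_ k.+1 (extend (r_ k) a i) v else a.

Lemma harm_node r_ k a :
  harm r_ k a = node a (fun i => harm r_ k.+1 (extend (r_ k) a i)).
Proof. by apply/funext => -[]. Qed.

Lemma harmonic_harm r_ rho_ k a :
  (forall i, 5 / 3 * r_ i + rho_ i = 1) ->
  harmonic_from r_ rho_ k 0 (harm r_ k a).
Proof.
move=> m; split=> // n _.
  elim: n k a => [|n IH] k a.
    rewrite vertex_sumS vertex_sum0 addn0 /= -vertex_form_extend.
    by apply: eq_bigr => i _; rewrite vertex_sum0.
  rewrite vertex_sumS [in RHS]vertex_sumS mulr_sumr; apply: eq_bigr => i _.
  by rewrite IH addSnnS.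
elim: n k a => [|n IH] k a.
  by rewrite edge_sum0 vertex_sum0 addn0 harm_node (edge_form_extend (m k)).
rewrite edge_sumS vertex_sumS mulr_sumr; apply: eq_bigr => i _.
by rewrite IH addSnnS.
Qed.

Lemma compat_node a W : (forall i, compat (W i)) -> (forall i, W i [::] i = a i) ->
  compat (node a W).
Proof. by move=> cW Wa [|j w] i /=; [exact: Wa|exact: cW]. Qed.

Lemma osc_node a W C : (forall i, geometric_osc C (W i)) ->
  (forall i j k, `|W i [::] j - a k| <= 5 / 3 * C) ->
  geometric_osc (5 / 3 * C) (node a W).
Proof.
move=> oW Wa [|l w] i j k /=; first by rewrite expr0 mulr1.
apply: le_trans (oW _ _ _ _ _) _.
by rewrite exprS le_eqVlt; apply/orP; left; apply/eqP; field.
Qed.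

Lemma compat_harm r_ k a : compat (harm r_ k a).
Proof.
by move=> w; elim: w k a => [|j w IH] k a i /=; [exact: extend_id|exact: IH].
Qed.

(** New values are convex combinations of the old ones, and differences inside
one subcell all have the factor [r]. *)
Lemma extend_osc (r D : R) a i : 0 <= r <= 3 / 5 ->
  (forall j k, `|a j - a k| <= D) ->
  (forall j k, `|extend r a i j - extend r a i k| <= D * (3 / 5)) /\
  (forall j k, `|extend r a i j - a k| <= D).
Proof.
move=> /andP[r0 r1] aD.
have D0 : 0 <= D by have := aD i i; exact: le_trans.
have aD' j k : - D <= a j - a k <= D by rewrite -ler_norml.
have /andP[a1 a2] := aD' i (ordS i); have /andP[b1 b2] := aD' i (ord_pred i).
have /andP[c1 c2] := aD' (ordS i) (ord_pred i).
split=> j k; rewrite ler_norml.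
  have [->|->|->] := ord3_cases i j; have [->|->|->] := ord3_cases i k;
  rewrite ?extendS ?extendp ?extend_id; apply/andP; split; nra.
have [->|->|->] := ord3_cases i j; have [->|->|->] := ord3_cases i k;
  rewrite ?extendS ?extendp ?extend_id; apply/andP; split; nra.
Qed.

Lemma osc_harm r_ k a D : (forall i, 0 <= r_ i <= 3 / 5) ->
  (forall j k, `|a j - a k| <= D) -> geometric_osc D (harm r_ k a).
Proof.
move=> r01 + w; elim: w k a D => [|l w IH] k a D aD i j j' /=.
  by rewrite expr0 mulr1; have [_] := extend_osc i (r01 k) aD; exact.
by rewrite exprS mulrA; apply: IH; have [] := extend_osc l (r01 k) aD.
Qed.

End tree_sums.

(** * Bump functions and their energy *)

Section bump.
Context {R : realType} (r_ rho_ : nat -> R).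
Context (m : forall i, matching_pair (r_ i) (rho_ i)).

Lemma ratio_range i : 0 <= r_ i <= 3 / 5.
Proof. by have [? ? ?] := m i; apply/andP; split; lra. Qed.

Definition off_vertex (i j : 'I_3) : R := (j != i)%:R.

Definition corner_tree k i := node (off_vertex i)
  (fun j => if j == i then harm r_ k (off_vertex i) else cst_tree 1).

(** 0 at the vertices of a cell, 1 at all the other vertices of its subcells: the
edges joining the subcells cost no energy, however small their resistance.
Inside, the corner subsubcells are filled harmonically, the six others by 1. *)
Definition core_tree k := node (fun=> 0) (corner_tree k).

(** [core_tree] placed in the cell [w] and extended by 0. *)
Fixpoint bump_tree k (w : seq 'I_3) {struct w} : seq 'I_3 -> 'I_3 -> R :=
  if w is i :: v then
    node (fun=> 0) (fun j => if j == i then bump_tree k.+1 v else cst_tree 0)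
  else core_tree k.+2.

Lemma bump_tree_nil k w : bump_tree k w [::] = fun=> 0.
Proof. by case: w. Qed.

Lemma off_vertex_id i : off_vertex i i = 0. Proof. by rewrite /off_vertex eqxx. Qed.

Lemma off_vertex_diff i j k : `|off_vertex i j - off_vertex i k| <= 1.
Proof. by rewrite /off_vertex ler_norml; case: eqP => _; case: eqP => _ /=; apply/andP; split; lra. Qed.

Lemma compat_cst (l : R) : compat (cst_tree l). Proof. by []. Qed.

Lemma compat_core k : compat (core_tree k).
Proof.
apply: compat_node => i; last by rewrite /= off_vertex_id.
apply: compat_node => j; case: eqP => [ji|/eqP ji].
- exact: compat_harm.
- exact: compat_cst.
- by [].
- by rewrite /cst_tree /off_vertex ji.
Qed.

Lemma compat_bump k w : compat (bump_tree k w).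
Proof.
elim: w k => [|i w IH] k /=; first exact: compat_core.
apply: compat_node => j; case: eqP => _.
- exact: IH.
- exact: compat_cst.
- by rewrite bump_tree_nil.
- by [].
Qed.

Lemma osc_cst (l C : R) : 0 <= C -> geometric_osc C (cst_tree l).
Proof. by move=> C0 w i j k; rewrite /cst_tree subrr normr0 mulr_ge0// exprn_ge0. Qed.

Lemma osc_bump k w : exists2 C, 1 <= C & geometric_osc C (bump_tree k w).
Proof.
elim: w k => [|i w IH] k /=.
  exists (5 / 3 * (5 / 3 * 1)); first lra.
  apply: osc_node => [i|i j _].
    apply: osc_node => [j|j l l']; case: ifP => _.
    - by apply: osc_harm; [exact: ratio_range|exact: off_vertex_diff].
    - exact: osc_cst.
    - by rewrite /=; have := off_vertex_diff i l l'; lra.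
    - by rewrite /cst_tree /off_vertex ler_norml; case: eqP => _ /=; apply/andP; split; lra.
  by rewrite subr0 /= /off_vertex; case: eqP => _ /=; rewrite ?normr0 ?normr1; lra.
have [C C1 oC] := IH k.+1; exists (5 / 3 * C); first lra.
have C53 : 0 <= 5 / 3 * C by lra.
apply: osc_node => [j|j l l']; case: ifP => _ //.
- by apply: osc_cst; lra.
- by rewrite bump_tree_nil subr0 normr0.
- by rewrite /cst_tree subr0 normr0.
Qed.

Lemma vertex_form_off_vertex i : vertex_form (off_vertex i) = 2.
Proof.
rewrite /vertex_form (sum_ord3 _ i) /off_vertex. rewrite ?ord3E ?eqxx ?ord3E /=. ring.
Qed.

Lemma harmonic_corner k i : harmonic_from r_ rho_ k 1 (corner_tree k.+1 i).
Proof.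
apply: harmonic_node => [j|].
  case: eqP => _; last exact: harmonic_cst.
  by apply: harmonic_harm => j'; have [] := m j'.
rewrite /edge_form (sum_ord3 _ i) /= ?ord3E /= ?eqxx /cst_tree /off_vertex ?ord3E /=.
by rewrite ord_pred_neq ordS_neq /=; ring.
Qed.

Lemma harmonic_bump k w : harmonic_from r_ rho_ k (size w).+2 (bump_tree k w).
Proof.
elim: w k => [|i w IH] k; apply: harmonic_node => [j|].
- exact: harmonic_corner.
- by rewrite /edge_form (sum_ord3 _ ord0) /= /off_vertex ?ord3E /=; ring.
- by case: eqP => _; [exact: IH|exact: harmonic_cst].
- have E (b : bool) l : (if b then bump_tree k.+1 w else cst_tree 0) [::] l = 0.
    by case: b; rewrite ?bump_tree_nil.
  by rewrite /edge_form big1// => j _; rewrite /= !E subrr expr0n.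
Qed.

Lemma vertex_sum_bump k w : vertex_sum (size w).+2 (bump_tree k w) = 6.
Proof.
elim: w k => [|i w IH] k; rewrite vertex_sumS.
  rewrite (eq_bigr (fun=> 2)) => [|i _].
    by rewrite sumr_const card_ord -mulr_natr; ring.
  rewrite vertex_sumS (sum_ord3 _ i) /= !ord3E eqxx !vertex_sum_cst !addr0.
  by rewrite vertex_sum0 vertex_form_off_vertex.
rewrite (sum_ord3 _ i) /= eqxx !ord3E !vertex_sum_cst !addr0; exact: IH.
Qed.

Lemma bump_tree_core k w i j v l : i != j -> bump_tree k w (w ++ [:: i, j & v]) l = 1.
Proof.
move=> ij; elim: w k => [|i' w IH] k /=; last by rewrite eqxx.
by rewrite eq_sym (negbTE ij).
Qed.

Lemma bump_tree_away k w w' v l : size w' = size w -> w' != w ->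
  bump_tree k w (w' ++ v) l = 0.
Proof.
elim: w w' k => [|i w IH] [|i' w']//= k [sz]; rewrite eqseq_cons.
by case: eqP => //= _ ww'; exact: IH.
Qed.

End bump.

Section energy_tree.
Context {R : realType} (p : 'I_3 -> 'rV[R]_2) (alpha : R) (K : set 'rV[R]_2).
Context (hp : unit_equilateral p) (ha : 0 < alpha < 1)
  (hK : hanoi_attractor p alpha K).
Context (r_ rho_ : nat -> R) (m : forall i, matching_pair (r_ i) (rho_ i)).
Local Notation xi := (edge_param p alpha).
Context (V : seq 'I_3 -> 'I_3 -> R) (C : R) (cV : compat V)
  (oV : geometric_osc C V).
Local Notation u := (tree_fun p alpha V).

Lemma tree_fun_QSigma n : QSigma p alpha n u = vertex_sum n V.
Proof.
apply: eq_bigr => w _; rewrite /Q0; apply: eq_bigr => i _ /=.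
by rewrite !(tree_fun_vertex hp ha hK cV).
Qed.

Lemma tree_fun_H1 w i : H1_01 (u \o xi w i).
Proof.
apply: (@H1_affine _ _ (V (rcons w (ordS i)) (ord_pred i))
 (V (rcons w (ord_pred i)) (ordS i) - V (rcons w (ordS i)) (ord_pred i))).
move=> t /andP[t0 t1]; rewrite /= (tree_fun_edge hp ha hK cV) ?(ltW t0) ?(ltW t1)//.
by ring.
Qed.

Lemma tree_fun_DI n : DI p alpha n.+1 u = (edge_sum n V)%:E.
Proof.
rewrite /DI /edge_sum -sumEFin; apply: eq_bigr => w _.
rewrite /edge_form -sumEFin; apply: eq_bigr => i _.
rewrite (@sqr_wderiv_affine _ _ (V (rcons w (ordS i)) (ord_pred i))
 (V (rcons w (ord_pred i)) (ordS i) - V (rcons w (ordS i)) (ord_pred i))).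
- by rewrite !cats1.
- exact: tree_fun_H1.
move=> t /andP[t0 t1]; rewrite /= (tree_fun_edge hp ha hK cV) ?(ltW t0) ?(ltW t1)//.
by ring.
Qed.

Lemma delta_gt0 n : 0 < delta r_ n.
Proof. by apply: prodr_gt0 => i _; have [] := m i. Qed.

Lemma deltaS n : delta r_ n.+1 = delta r_ n * r_ n.
Proof. by rewrite /delta big_ord_recr. Qed.

(** From level [N] on, a refinement at level [n] moves the share [rho_ n] of the
renormalized vertex sum [x n] into the edges. So the edges receive in total
[x N - lim x], and [lim x] is what remains for the vertices. *)
Lemma energy_tree N : harmonic_from r_ rho_ 0 N V ->
  energy p alpha r_ rho_ u = ((delta r_ N)^-1 * vertex_sum N V)%:E.
Proof.
move=> [hQ hD hD0].
pose x n := (delta r_ n)^-1 * vertex_sum n V.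
have xS n : (N <= n)%N -> x n.+1 = x n * (1 - rho_ n).
  move=> Nn; rewrite /x hQ// deltaS.
  have d0 := delta_gt0 n; have [r0 _ mm] := m n.
  have -> : 1 - rho_ n = 5 / 3 * r_ n by lra.
  by field; rewrite !gt_eqF.
have x0 n : 0 <= x n.
  rewrite mulr_ge0 ?invr_ge0 ?(ltW (delta_gt0 n))//.
  by apply: sumr_ge0 => w _; apply: sumr_ge0 => i _; exact: sqr_ge0.
have part n : (\sum_(1 <= k < (N + n).+1) ((gamma r_ rho_ k)^-1)%:E * DI p alpha k u
    = (x N - x (N + n)%N)%:E)%E.
  rewrite big_add1 /=; elim: n => [|n IH].
    rewrite addn0 subrr big_nat big1// => k /andP[_ kN].
    by rewrite tree_fun_DI hD0// mule0.
  rewrite addnS big_nat_recr//= IH tree_fun_DI hD ?leq_addr// -EFinM -EFinD; congr EFin.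
  rewrite xS ?leq_addr// /gamma /= /x add0n.
  have d0 := delta_gt0 (N + n); have [_ rho0 _] := m (N + n)%N.
  by have dN := delta_gt0 N; field; rewrite !gt_eqF.
pose y n := x (N + n)%N.
have y_ni : nonincreasing_seq y.
  apply/nonincreasing_seqP => n; rewrite /y addnS xS ?leq_addr//.
  have := x0 (N + n)%N; have [r0 rho0 mm] := m (N + n)%N; nra.
have cy : cvgn y.
  by apply: nonincreasing_is_cvgn => //; exists 0 => _ [n _ <-]; exact: x0.
have ES : energySigma p alpha r_ u = (limn y)%:E.
  apply: cvg_lim => //; rewrite -(cvg_shiftn N) /=.
  apply: cvg_EFin; first exact: nearW.
  apply: cvg_trans cy; apply: near_eq_cvg; apply: nearW => n /=.
  by rewrite tree_fun_QSigma /y /x addnC.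
have EI : energyI p alpha r_ rho_ u = (x N - limn y)%:E.
  apply: cvg_lim => //; rewrite -(cvg_shiftn N.+1) /=.
  rewrite (_ : (fun n => _) = (fun n => (x N - y n)%:E)); last first.
    by apply/funext => n; rewrite addnS addnC part.
  apply: cvg_EFin; first exact: nearW.
  by apply: cvgB; [exact: cvg_cst|exact: cy].
by rewrite /energy ES EI -EFinD addrC subrK.
Qed.

Lemma energy_domain_tree N : harmonic_from r_ rho_ 0 N V ->
  energy_domain p alpha r_ rho_ K u.
Proof.
move=> hV; split.
- exact: (tree_fun_continuous hp ha hK cV oV).
- by rewrite (energy_tree hV) ltry.
- exact: tree_fun_H1.
Qed.

End energy_tree.

(** * Lower bounds for the energy *)

Section trace.
Context {R : realType}.
Implicit Types (V : seq 'I_3 -> 'I_3 -> R).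

(** The two sides differ by the energy of the deviation of [V] from the harmonic
extension of its boundary values: there is no cross term, the deviation being 0
at the vertices where the extension fails to be harmonic. *)
Lemma trace_le (r rho : R) V : matching_pair r rho -> compat V ->
  vertex_form (V [::]) <=
  r^-1 * (\sum_(i < 3) vertex_form (V [:: i])) + rho^-1 * edge_form V.
Proof.
move=> [r0 rho0 m] cV.
pose d i j := V [:: i] j - extend r (V [::]) i j.
rewrite -subr_ge0.
suff -> : r^-1 * (\sum_(i < 3) vertex_form (V [:: i])) + rho^-1 * edge_form V -
   vertex_form (V [::]) = r^-1 * (\sum_(i < 3) vertex_form (d i)) +
   rho^-1 * \sum_(i < 3) (d (ord_pred i) (ordS i) - d (ordS i) (ord_pred i)) ^+ 2.
  by apply: addr_ge0; apply: mulr_ge0; rewrite ?invr_ge0 ?(ltW r0) ?(ltW rho0)//;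
    apply: sumr_ge0 => i _; rewrite ?sqr_ge0//; apply: sumr_ge0 => j _; exact: sqr_ge0.
have E : rho = 1 - 5 / 3 * r by lra.
have rho0' : 1 - 5 / 3 * r != 0 by rewrite -E gt_eqF.
have c1 i : V [:: i] i = V [::] i := cV [::] i.
rewrite /edge_form /vertex_form !(sum_ord3 _ ord0) /d !ord3E !c1.
rewrite !extend_id.
rewrite /extend !ord3E !(sum_ord3 _ ord0).
rewrite E; field.
by rewrite gt_eqF//=; have := rho0; rewrite E; lra.
Qed.

Lemma vertex_sum_le (r rho : R) n V : matching_pair r rho -> compat V ->
  vertex_sum n V <= r^-1 * vertex_sum n.+1 V + rho^-1 * edge_sum n V.
Proof.
move=> m; elim: n V => [|n IH] V cV.
  rewrite vertex_sumS; under eq_bigr do rewrite vertex_sum0.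
  by rewrite vertex_sum0 edge_sum0; exact: trace_le.
rewrite vertex_sumS [vertex_sum n.+2 V]vertex_sumS edge_sumS !mulr_sumr -big_split /=.
by apply: ler_sum => i _; apply: IH; exact: compat_sub.
Qed.
End trace.

Section energy_domain.
Context {R : realType} (p : 'I_3 -> 'rV[R]_2) (alpha : R) (K : set 'rV[R]_2).
Context (ha : 0 < alpha < 1) (hK : hanoi_attractor p alpha K).
Context (r_ rho_ : nat -> R) (m : forall i, matching_pair (r_ i) (rho_ i)).
Local Notation mu := (@lebesgue_measure R).
Local Notation Gw := (Gword p alpha).
Local Notation xi := (edge_param p alpha).
Local Notation E := (energy p alpha r_ rho_).

Lemma DI_ge0 k u : (0 <= DI p alpha k u)%E.
Proof.
apply: sume_ge0 => w _; apply: sume_ge0 => i _; apply: integral_ge0 => x _.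
by rewrite lee_fin sqr_ge0.
Qed.

Lemma gamma_gt0 n : 0 < gamma r_ rho_ n.
Proof. by rewrite /gamma mulr_gt0 ?(delta_gt0 m)//; have [] := m n.-1. Qed.

Lemma energyI_ge0 u : (0 <= energyI p alpha r_ rho_ u)%E.
Proof.
apply: nneseries_ge0 => k _ _; apply: mule_ge0; last exact: DI_ge0.
by rewrite lee_fin invr_ge0 ltW// gamma_gt0.
Qed.

Lemma QSigma_ge0 n u : 0 <= QSigma p alpha n u.
Proof. by apply: sumr_ge0 => w _; apply: sumr_ge0 => i _; exact: sqr_ge0. Qed.

(** A limit that does not exist has the default value 0. *)
Lemma energySigma_ge0 u : (0 <= energySigma p alpha r_ u)%E.
Proof.
rewrite /energySigma.
set f := (fun n => _); have [cf|] := pselect (cvgn f).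
  apply: lime_ge => //; apply: nearW => n; rewrite lee_fin mulr_ge0 ?QSigma_ge0//.
  by rewrite invr_ge0 ltW// (delta_gt0 m).
by move=> /dvgP ->.
Qed.

Lemma energy_ge0 u : (0 <= E u)%E.
Proof. by apply: adde_ge0; [exact: energySigma_ge0|exact: energyI_ge0]. Qed.

Lemma energyI_fin u : (E u < +oo)%E -> energyI p alpha r_ rho_ u \is a fin_num.
Proof.
move=> Eoo; rewrite ge0_fin_numE ?energyI_ge0//; apply: le_lt_trans Eoo.
by rewrite leeDr// energySigma_ge0.
Qed.

Lemma energyI_term_le u k : (0 < k)%N ->
  (((gamma r_ rho_ k)^-1)%:E * DI p alpha k u <= energyI p alpha r_ rho_ u)%E.
Proof.
move=> k0; rewrite /energyI.
have g0 i : (0 <= ((gamma r_ rho_ i)^-1)%:E * DI p alpha i u)%E.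
  by apply: mule_ge0; [rewrite lee_fin invr_ge0 ltW// gamma_gt0|exact: DI_ge0].
apply: (@le_trans _ _ (\sum_(1 <= i < k.+1) ((gamma r_ rho_ i)^-1)%:E * DI p alpha i u)%E).
  rewrite big_nat_recr//= leeDr//; apply: sume_ge0 => *; exact: g0.
by apply: nneseries_lim_ge => i _ _; exact: g0.
Qed.

Lemma sume_ge_term (I : finType) (F : I -> \bar R) j :
  (forall i, (0 <= F i)%E) -> (F j <= \sum_i F i)%E.
Proof. by move=> F0; rewrite (bigD1 j)//= leeDl// sume_ge0. Qed.

Lemma edge_int_le w i u :
  (\int[mu]_(x in `]0%R, 1%R[) ((wderiv_01 (u \o xi w i) x) ^+ 2)%:E <=
   DI p alpha (size w).+1 u)%E.
Proof.
have int0 v j : (0 <= \int[mu]_(x in `]0%R, 1%R[) ((wderiv_01 (u \o xi v j) x) ^+ 2)%:E)%E.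
  by apply: integral_ge0 => x _; rewrite lee_fin sqr_ge0.
apply: le_trans (@sume_ge_term _ (fun v : (size w).-tuple 'I_3 => \sum_(j < 3)
  \int[mu]_(x in `]0%R, 1%R[) ((wderiv_01 (u \o xi v j) x) ^+ 2)%:E)%E
  (in_tuple w) _); last by move=> v; apply: sume_ge0.
by apply: (@sume_ge_term _ (fun j =>
  \int[mu]_(x in `]0%R, 1%R[) ((wderiv_01 (u \o xi w j) x) ^+ 2)%:E)%E).
Qed.

Lemma edge_param_continuous w i : continuous (xi w i : R -> 'rV[R]_2).
Proof.
move=> t; rewrite /edge_param.
elim: w => [|j w IH] /=.
  apply: cvgD; apply: cvgZr_tmp; last exact: cvg_id.
  by apply: cvgB; [exact: cvg_cst|exact: cvg_id].
by rewrite /Gmap; apply: cvgD; [apply: cvgZl_tmp; apply: cvgB => //; exact: cvg_cst|exact: cvg_cst].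
Qed.

Lemma edge_continuous u w i : {within K, continuous u} ->
  {within `[0, 1], continuous (u \o xi w i : R -> R)}.
Proof.
move=> /subspace_continuousP cu; apply/subspace_continuousP => t.
rewrite /= in_itv /= => t01.
apply: (@cvg_comp _ _ _ (xi w i) u _ (within K (nbhs (xi w i t)))); last first.
  by apply: cu; exact: (attractor_closed_edge ha hK).
move=> A; rewrite /within /= => xiA.
have {}xiA : nbhs t ((xi w i : R -> 'rV[R]_2) @^-1` (fun y => K y -> A y)).
  exact: (@edge_param_continuous w i t _ xiA).
apply: filterS xiA => s As s01.
by apply: As; apply: (attractor_closed_edge ha hK); move: s01; rewrite in_itv.
Qed.

Section one_function.
Context (u : 'rV[R]_2 -> R) (hu : energy_domain p alpha r_ rho_ K u).

Let cu : {within K, continuous u}. Proof. by case: hu. Qed.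
Let Hu w i : H1_01 (u \o xi w i). Proof. by case: hu. Qed.
Let Eu : (E u < +oo)%E. Proof. by case: hu. Qed.

Lemma edge_int_fin w i :
  (\int[mu]_(x in `]0%R, 1%R[) ((wderiv_01 (u \o xi w i) x) ^+ 2)%:E)%E \is a fin_num.
Proof.
have [Lg _] := wderivP (Hu w i).
by apply: integrable_fin_num => //; exact: L2_integrable_sqr.
Qed.

Lemma DI_fin k : DI p alpha k u \is a fin_num.
Proof.
by apply/sum_fin_numP => w _ _; apply/sum_fin_numP => i _ _; exact: edge_int_fin.
Qed.

Lemma edge_osc w i s t : 0 <= s -> s <= t -> t <= 1 ->
  (u (xi w i t) - u (xi w i s)) ^+ 2 <=
  (t - s) * (gamma r_ rho_ (size w).+1 * fine (E u)).
Proof.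
move=> s0 st t1.
apply: le_trans (H1_difference (Hu w i) (edge_continuous cu) s0 st t1) _.
rewrite ler_wpM2l ?subr_ge0// -ler_pdivrMl ?gamma_gt0//.
rewrite -lee_fin fineK; last first.
  by rewrite ge0_fin_numE ?energy_ge0.
rewrite EFinM /Rintegral fineK ?edge_int_fin//.
apply: (@le_trans _ _ (energyI p alpha r_ rho_ u)); last by rewrite leeDr// energySigma_ge0.
apply: le_trans (energyI_term_le u (ltn0Sn (size w))).
by rewrite lee_pmul2l ?edge_int_le ?lte_fin ?invr_gt0 ?gamma_gt0.
Qed.

Let V w k := u (Gw w (p k)).

Let cV : compat V.
Proof. by move=> w i; rewrite /V Gword_rcons Gmap_fix. Qed.

Lemma QSigma_vertex_sum n : QSigma p alpha n u = vertex_sum n V.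
Proof. by []. Qed.

Lemma edge_sum_DI n : ((edge_sum n V)%:E <= DI p alpha n.+1 u)%E.
Proof.
rewrite /DI /edge_sum -sumEFin; apply: lee_sum => w _.
rewrite /edge_form -sumEFin; apply: lee_sum => i _.
have := H1_difference (Hu w i) (@edge_continuous _ w i cu) (lexx 0) ler01 (lexx 1).
rewrite subr0 mul1r /= edge_param0 edge_param1 /V !cats1 !Gword_rcons.
by rewrite -lee_fin /Rintegral fineK ?edge_int_fin.
Qed.

(** By [vertex_sum_le] the renormalized vertex sum plus the edge energy of the
levels passed so far is nondecreasing. The edge energy converges to a finite
value, so the vertex sums converge too, and the limit of the total is the
energy. *)
Lemma energy_ge_QSigma n : (delta r_ n)^-1 * QSigma p alpha n u <= fine (E u).
Proof.
pose y n := (delta r_ n)^-1 * QSigma p alpha n u.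
pose s n := \sum_(1 <= k < n.+1) (gamma r_ rho_ k)^-1 * fine (DI p alpha k u).
have sE k : (s k)%:E = (\sum_(1 <= k < k.+1) ((gamma r_ rho_ k)^-1)%:E * DI p alpha k u)%E.
  by rewrite -sumEFin; apply: eq_bigr => i _; rewrite EFinM fineK// DI_fin.
have gD k : 0 <= (gamma r_ rho_ k)^-1 * fine (DI p alpha k u).
  by rewrite mulr_ge0 ?invr_ge0 ?(ltW (gamma_gt0 _))// fine_ge0// DI_ge0.
have s0 k : 0 <= s k by apply: sumr_ge0 => i _; exact: gD.
have ys_nd : nondecreasing_seq (fun n => (y n + s n)%:E).
  apply/nondecreasing_seqP => k; rewrite lee_fin /s [X in _ <= _ + X]big_nat_recr//= addrA.
  rewrite [leRHS]addrAC lerD2r /y !QSigma_vertex_sum.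
  have d0 := delta_gt0 m k; have [rk rhok _] := m k.
  rewrite -(ler_pM2l d0) mulrDr !mulrA mulfV ?gt_eqF// mul1r (deltaS r_).
  apply: le_trans (vertex_sum_le k (m k) cV) _; apply: lerD.
    by rewrite invfM mulrA mulfV ?gt_eqF// mul1r.
  rewrite /gamma /= invfM mulrA mulfV ?gt_eqF// mul1r ler_wpM2l ?invr_ge0 ?(ltW rhok)//.
  by rewrite -lee_fin fineK ?DI_fin// edge_sum_DI.
have scv : (s k)%:E @[k --> \oo] --> energyI p alpha r_ rho_ u.
  pose P k := (\sum_(1 <= i < k) ((gamma r_ rho_ i)^-1)%:E * DI p alpha i u)%E.
  have Pcv : P @ \oo --> energyI p alpha r_ rho_ u.
    apply: is_cvg_nneseries => k _ _; apply: mule_ge0; last exact: DI_ge0.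
    by rewrite lee_fin invr_ge0 ltW// gamma_gt0.
  rewrite -cvg_shiftS in Pcv.
  by have -> : (fun k => (s k)%:E) = (fun k => P k.+1) by apply/funext.
have Sfin := energyI_fin Eu.
set S := energyI p alpha r_ rho_ u in scv Sfin.
have yscv := ereal_nondecreasing_cvgn ys_nd.
set L := ereal_sup _ in yscv.
have ES : energySigma p alpha r_ u = (L - S)%E.
  apply: cvg_lim => //.
  have := cvgeB _ yscv scv.
  rewrite fin_num_adde_defl ?fin_numN// => /(_ _ isT); apply: cvg_trans; apply: near_eq_cvg; apply: nearW => k /=.
  by rewrite -EFinB addrK.
have EL : E u = L by rewrite /energy ES subeK.
rewrite -lee_fin fineK; last by rewrite ge0_fin_numE ?energy_ge0.
rewrite EL; apply: (@le_trans _ _ (y n + s n)%:E).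
  by rewrite lee_fin lerDl.
by apply: ereal_sup_ubound; exists n.
Qed.

End one_function.
End energy_domain.

(** * Bounds for the resistance metric *)

Section resistance.
Context {R : realType} (p : 'I_3 -> 'rV[R]_2) (alpha : R) (K : set 'rV[R]_2).
Context (ha : 0 < alpha < 1) (hK : hanoi_attractor p alpha K).
Context (r_ rho_ : nat -> R) (m : forall i, matching_pair (r_ i) (rho_ i)).
Local Notation Gw := (Gword p alpha).
Local Notation xi := (edge_param p alpha).
Local Notation E := (energy p alpha r_ rho_).
Local Notation dom := (energy_domain p alpha r_ rho_ K).
Local Notation rm := (resistance_metric p alpha r_ rho_ K).

Lemma energy_finE u : dom u -> E u = (fine (E u))%:E.
Proof. by move=> [_ Eu _]; rewrite fineK// ge0_fin_numE ?(energy_ge0 p alpha m). Qed.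

Lemma inf_energy_ge x y (B : R) : 0 < B ->
  (forall u, dom u -> (u x - u y) ^+ 2 <= B * fine (E u)) ->
  ((B^-1)%:E <= ereal_inf (E @` [set u | [/\ dom u, u x = 0 & u y = 1]%R]))%E.
Proof.
move=> B0 H; apply: le_ereal_inf_tmp => _ [u [Du ux uy] <-].
rewrite energy_finE// lee_fin -[leLHS]mulr1 ler_pdivrMl//.
by have := H u Du; rewrite ux uy sub0r sqrrN expr1n.
Qed.

Lemma resistance_ge0 x y : 0 <= rm x y.
Proof.
rewrite /resistance_metric; case: eqVneq => // xy.
by rewrite invr_ge0 fine_ge0//; apply: le_ereal_inf_tmp => _ [u _ <-]; exact: (energy_ge0 p alpha m).
Qed.

Lemma resistance_le x y (B : R) : 0 <= B ->
  (forall u, dom u -> (u x - u y) ^+ 2 <= B * fine (E u)) -> rm x y <= B.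
Proof.
move=> B0 H; rewrite /resistance_metric; case: eqVneq => // xy.
set I := ereal_inf _.
have [[u [Du ux uy]]|A0] := pselect (exists u, [/\ dom u, u x = 0 & u y = 1]); last first.
  rewrite /I (_ : E @` _ = set0) ?ereal_inf0 ?invr0//.
  by rewrite -subset0 => t [u Au _]; apply: A0; exists u.
have Bpos : 0 < B.
  rewrite lt_neqAle B0 andbT eq_sym; apply/negP => /eqP B00.
  by have := H u Du; rewrite ux uy sub0r sqrrN expr1n B00 mul0r ler10.
have IB := inf_energy_ge Bpos H; rewrite -/I in IB.
have Ifin : I \is a fin_num.
  rewrite ge0_fin_numE; last by apply: le_trans IB; rewrite lee_fin invr_ge0.
  apply: le_lt_trans (_ : I <= E u)%E _; first by apply: ereal_inf_lbound; exists u.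
  by case: Du.
rewrite -(invrK B) lef_pV2 ?posrE ?invr_gt0//; rewrite -?lee_fin ?fineK//.
by rewrite -lte_fin fineK// (lt_le_trans _ IB)// lte_fin invr_gt0.
Qed.

(** The a priori bound by [B] makes the infimum of the energies positive, so that
its inverse is a genuine one. *)
Lemma resistance_ge x y (A B : R) u : x != y -> 0 < A -> 0 < B ->
  (forall u, dom u -> (u x - u y) ^+ 2 <= B * fine (E u)) ->
  dom u -> u x = 0 -> u y = 1 -> (E u <= A%:E)%E -> A^-1 <= rm x y.
Proof.
move=> xy A0 B0 H Du ux uy EA; rewrite /resistance_metric (negbTE xy).
set I := ereal_inf _.
have IB := inf_energy_ge B0 H; rewrite -/I in IB.
have IA : (I <= A%:E)%E by apply: le_trans EA; apply: ereal_inf_lbound; exists u.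
have Ifin : I \is a fin_num.
  rewrite ge0_fin_numE; last by apply: le_trans IB; rewrite lee_fin invr_ge0 ltW.
  exact: le_lt_trans IA (ltry _).
rewrite lef_pV2 ?posrE//; first by rewrite -lee_fin fineK.
by rewrite -lte_fin fineK// (lt_le_trans _ IB)// lte_fin invr_gt0.
Qed.

Lemma delta_le n : delta r_ n.+1 <= 3 / 5 * delta r_ n.
Proof.
have d0 := delta_gt0 m n; have [r0 rho0 mm] := m n.
by rewrite deltaS mulrC ler_wpM2r ?(ltW d0)//; lra.
Qed.

Lemma gamma_le n : gamma r_ rho_ n.+1 <= delta r_ n.
Proof.
have d0 := delta_gt0 m n; have [r0 rho0 mm] := m n.
by rewrite /gamma /= ler_piMr ?(ltW d0)//; lra.
Qed.

Lemma delta_le1 n : delta r_ n <= 1.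
Proof.
elim: n => [|n IH]; first by rewrite /delta big_ord0.
by have := delta_le n; have := delta_gt0 m n; lra.
Qed.

Section one_function.
Context (u : 'rV[R]_2 -> R) (hu : dom u).
Let e := fine (E u).
Let e0 : 0 <= e. Proof. exact/fine_ge0/energy_ge0. Qed.
Let s n := Num.sqrt (delta r_ n * e).

Let s0 n : 0 <= s n. Proof. exact: sqrtr_ge0. Qed.

Let sS n : s n.+1 <= 4 / 5 * s n.
Proof.
(* 3/5 is less than the square of 4/5 *)
have -> : 4 / 5 = Num.sqrt ((4 / 5) ^+ 2) :> R by rewrite sqrtr_sqr ger0_norm.
rewrite -sqrtrM ?sqr_ge0// ler_wsqrtr// mulrA ler_wpM2r//.
apply: le_trans (delta_le n) _; rewrite ler_wpM2r ?(ltW (delta_gt0 m _))//.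
by rewrite expr2; lra.
Qed.

Let le_s (a b : R) n : (a - b) ^+ 2 <= delta r_ n * e -> `|a - b| <= s n.
Proof. by move=> h; rewrite -sqrtr_sqr ler_wsqrtr. Qed.

Lemma vertex_dist w i j : `|u (Gw w (p i)) - u (Gw w (p j))| <= s (size w).
Proof.
have H k : `|u (Gw w (p k)) - u (Gw w (p (ordS k)))| <= s (size w).
  apply: le_s; have := energy_ge_QSigma ha hK m hu (size w).
  rewrite ler_pdivrMl ?(delta_gt0 m)// => QE; apply: le_trans QE.
  rewrite /QSigma (bigD1 (in_tuple w))//= -[leLHS]addr0 lerD//.
    rewrite /Q0 (bigD1 k)//= lerDl; apply: sumr_ge0 => l _; exact: sqr_ge0.
  by apply: sumr_ge0 => v _; apply: sumr_ge0 => l _; exact: sqr_ge0.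
have [->|->|->] := ord3_cases i j; first by rewrite subrr normr0.
  exact: H.
by have := H (ord_pred i); rewrite ord_predK distrC.
Qed.

Lemma edge_dist w i a b : 0 <= a <= 1 -> 0 <= b <= 1 ->
  (u (xi w i a) - u (xi w i b)) ^+ 2 <= `|a - b| * (gamma r_ rho_ (size w).+1 * e).
Proof.
wlog ba : a b / b <= a => [wl a01 b01|].
  have [ba|ab] := leP b a; first exact: wl.
  by rewrite distrC -sqrrN opprB; apply: wl => //; exact: ltW.
move=> /andP[_ a1] /andP[b0 _]; rewrite ger0_norm ?subr_ge0//.
exact: (edge_osc ha hK m hu).
Qed.

Lemma edge_dist_level w i a b : 0 <= a <= 1 -> 0 <= b <= 1 ->
  `|u (xi w i a) - u (xi w i b)| <= s (size w).
Proof.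
move=> a01 b01; apply: le_s; apply: le_trans (edge_dist w i a01 b01) _.
apply: (@le_trans _ _ (gamma r_ rho_ (size w).+1 * e)).
  apply: ler_piMl; first by apply: mulr_ge0 => //; exact: ltW (gamma_gt0 m _).
  by rewrite ler_norml; move: a01 b01 => /andP[? ?] /andP[? ?]; apply/andP; split; lra.
by rewrite ler_wpM2r// gamma_le.
Qed.

Lemma edge_ends_dist w i j : i != j ->
  `|u (Gw (rcons w i) (p j)) - u (Gw (rcons w j) (p i))| <= s (size w).
Proof.
have h0 : 0 <= (0 : R) <= 1 by rewrite lexx ler01.
have h1 : 0 <= (1 : R) <= 1 by rewrite lexx ler01.
have [->|->|->] := ord3_cases i j; rewrite ?eqxx// => _.
  have := edge_dist_level w (ord_pred i) h0 h1.
  by rewrite edge_param0 edge_param1 !Gword_rcons !ord3E.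
have := edge_dist_level w (ordS i) h1 h0.
by rewrite edge_param0 edge_param1 !Gword_rcons !ord3E.
Qed.

Lemma subcell_dist w i :
  `|u (Gw (rcons w i) (p ord0)) - u (Gw w (p ord0))| <= 2 * s (size w).
Proof.
have -> : Gw w (p ord0) = Gw (rcons w ord0) (p ord0) by rewrite Gword_rcons Gmap_fix.
have := s0 (size w); have := sS (size w).
have [->|i0] := eqVneq i ord0; first by rewrite subrr normr0; lra.
have := edge_ends_dist w i0; have := vertex_dist (rcons w ord0) i ord0.
rewrite size_rcons !ler_norml => /andP[? ?] /andP[? ?] ? ?.
by apply/andP; split; lra.
Qed.

Lemma edge_vertex_dist w i t : 0 <= t <= 1 ->
  `|u (xi w i t) - u (Gw w (p ord0))| <= 4 * s (size w).
Proof.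
move=> t01; have h0 : 0 <= (0 : R) <= 1 by rewrite lexx ler01.
have := edge_dist_level w i t01 h0; rewrite edge_param0 -Gword_rcons.
have := vertex_dist (rcons w (ordS i)) (ord_pred i) ord0.
have := subcell_dist w (ordS i); have := s0 (size w); have := sS (size w).
rewrite size_rcons !ler_norml => ? ? /andP[? ?] /andP[? ?] /andP[? ?].
by apply/andP; split; lra.
Qed.

(** Chaining: the point [z] is reached from a vertex of the cell through
successive subcells, at a cost of at most [4 * s n] at level [n]. As [s]
decreases by the factor 4/5 at each level, the total is [20 * s (size w)]. *)
Lemma approx_in_cell (D : R) : (forall x, K x -> `|x - p ord0| <= D) ->
  forall n w x, K x -> exists z, [/\ K z, `|x - z| <= ((1 - alpha) / 2) ^+ n * D &
    `|u (Gw w z) - u (Gw w (p ord0))| <= 20 * s (size w)].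
Proof.
move=> KD; elim=> [|n IH] w x Kx.
  exists (p ord0); split; first exact: (attractor_vertex ha hK).
    by rewrite expr0 mul1r KD.
  by rewrite subrr normr0 mulr_ge0.
have [[i [y [Ky ->]]]|[i [t [/andP[t0 t1] xE]]]] := attractor_cases hK Kx; last first.
  exists x; split => //.
    have /andP[? ?] := ha.
    by rewrite subrr normr0 mulr_ge0 ?exprn_ge0//; [lra|exact: le_trans (KD x Kx)].
  have := @edge_vertex_dist w i t; rewrite -[w in xi w]cats0 edge_param_cat -xE (ltW t0) (ltW t1).
  by move=> /(_ isT); have := s0 (size w); lra.
have [z [Kz yz uz]] := IH (rcons w i) y Ky.
exists (Gmap p alpha i z); split; first exact: (attractor_Gmap hK).
  rewrite /Gmap opprD addrACA subrr addr0 -scalerBr opprB addrA subrK normrZ.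
  have /andP[a0 a1] := ha; rewrite ger0_norm; last lra.
  by rewrite exprS -mulrA ler_wpM2l//; lra.
rewrite -Gword_rcons; move: uz (subcell_dist w i) (sS (size w)) (s0 (size w)).
by rewrite size_rcons !ler_norml => /andP[? ?] /andP[? ?] ? ?; apply/andP; split; lra.
Qed.

Lemma Gword_continuous w : continuous (Gw w).
Proof.
elim: w => [|j w IH] x /=; first exact: cvg_id.
have F : Filter (nbhs x) by exact: nbhs_filter.
have C : (cst (p j) : 'rV[R]_2 -> 'rV[R]_2) @ nbhs x --> p j by exact: cvg_cst.
have H1 := @cvgB R 'rV[R]_2 _ (nbhs x) F _ (cst (p j)) _ _ (IH x) C.
have H2 := @cvgZl_tmp R _ 'rV[R]_2 (nbhs x) F ((1 - alpha) / 2) _ _ H1.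
exact: (@cvgD R 'rV[R]_2 _ (nbhs x) F _ (cst (p j)) _ _ H2 C).
Qed.

(** The points of [approx_in_cell] approach [x], and [u] is continuous on [K]. *)
Lemma cell_center_dist w x : K x ->
  `|u (Gw w x) - u (Gw w (p ord0))| <= 20 * s (size w).
Proof.
move=> Kx; have /andP[a0 a1] := ha.
have [D KD] : exists D, forall x, K x -> `|x - p ord0| <= D.
  have [M [_ KM]] := compact_bounded (attractor_compact hK).
  exists (`|M| + 1 + `|p ord0|) => y Ky; apply: le_trans (ler_normB _ _) _.
  rewrite lerD2r; apply: (KM (`|M| + 1)) => //.
  by rewrite (le_lt_trans (ler_norm _))// ltrDl.
apply/ler_addgt0Pr => eps eps0.
have cu : {within K, continuous u} by case: hu.
have : \forall z \near x, K z -> `|u (Gw w x) - u (Gw w z)| < eps.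
  have /subspace_continuousP /(_ _ (attractor_Gword hK w Kx)) /cvgrPdist_lt /(_ _ eps0) := cu.
  rewrite near_withinE => H.
  have : \forall z \near x, K (Gw w z) -> `|u (Gw w x) - u (Gw w z)| < eps.
    exact: (@Gword_continuous w x _ H).
  apply: filterS => z /= Hz Kz.
  by apply: Hz; exact: (attractor_Gword hK).
move=> /nbhs_ballP[d /= d0 Hd].
have : (fun n => ((1 - alpha) / 2) ^+ n * D) @ \oo --> 0.
  rewrite -[X in _ --> X](mul0r D); apply: cvgMl; apply: cvg_expr.
  by rewrite ger0_norm; lra.
move=> /cvgrPdist_lt /(_ _ d0) [n _ /(_ n (leqnn n))]; rewrite sub0r normrN => nd.
have [z [Kz xz uz]] := approx_in_cell KD n w Kx.
have := Hd z; rewrite -ball_normE /= => /(_ (le_lt_trans xz (le_lt_trans (ler_norm _) nd)) Kz).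
move: uz; rewrite ler_norml ltr_norml ler_norml => /andP[? ?] /andP[? ?].
by apply/andP; split; lra.
Qed.

Lemma cell_dist w x y : K x -> K y ->
  (u (Gw w x) - u (Gw w y)) ^+ 2 <= 40 ^+ 2 * delta r_ (size w) * e.
Proof.
move=> Kx Ky; have := cell_center_dist w Kx; have := cell_center_dist w Ky.
have ss : s (size w) ^+ 2 = delta r_ (size w) * e.
  by rewrite sqr_sqrtr// mulr_ge0// ltW// (delta_gt0 m).
rewrite -mulrA -ss -exprMn -[X in _ -> _ -> X <= _](real_normK (num_real _)).
rewrite !ler_norml => /andP[? ?] /andP[? ?]; apply: lerXn2r; rewrite ?nnegrE//.
  by rewrite mulr_ge0.
by rewrite ler_norml; apply/andP; split; lra.
Qed.

End one_function.
End resistance.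

Section metric_bounds.
Context {R : realType} (p : 'I_3 -> 'rV[R]_2) (alpha : R) (K : set 'rV[R]_2).
Context (hp : unit_equilateral p) (ha : 0 < alpha < 1)
  (hK : hanoi_attractor p alpha K).
Context (r_ rho_ : nat -> R) (m : forall i, matching_pair (r_ i) (rho_ i)).
Local Notation Gw := (Gword p alpha).
Local Notation xi := (edge_param p alpha).
Local Notation rm := (resistance_metric p alpha r_ rho_ K).

Lemma resistance_cell_le w x y : K x -> K y ->
  rm (Gw w x) (Gw w y) <= 40 ^+ 2 * delta r_ (size w).
Proof.
move=> Kx Ky; apply: (resistance_le m); first by apply: mulr_ge0; [exact: sqr_ge0|exact: ltW (delta_gt0 m _)].
by move=> u hu; exact: (cell_dist ha hK m hu).
Qed.

Lemma resistance_edge_le w i s t : 0 <= s <= 1 -> 0 <= t <= 1 ->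
  rm (xi w i s) (xi w i t) <= `|s - t|.
Proof.
move=> s01 t01; apply: (resistance_le m) => // u hu.
apply: le_trans (edge_dist ha hK m hu w i s01 t01) _.
rewrite ler_wpM2l// ler_piMl//; first exact/fine_ge0/(energy_ge0 p alpha m).
exact: le_trans (gamma_le m _) (delta_le1 m _).
Qed.

(** The bump function of the cell [w] is 1 on the cell [w i j], 0 on the cell [v],
and has energy [6 / delta r_ (size w).+2]. *)
Lemma resistance_separated_ge v w i j x y : size v = size w -> v != w -> i != j -> K x -> K y ->
  delta r_ (size w).+2 / 6 <= rm (Gw v y) (Gw (w ++ [:: i; j]) x).
Proof.
move=> vw vnw ij Kx Ky.
pose V := bump_tree r_ 0 w.
have [C C1 oV] := osc_bump m 0 w.
have cV : compat V := compat_bump r_ 0 w.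
have hV := harmonic_bump m 0 w.
pose u := tree_fun p alpha V.
have uy : u (Gw v y) = 0.
  apply: (tree_fun_cst hp ha hK _ Ky) => v' l; exact: bump_tree_away.
have ux : u (Gw (w ++ [:: i; j]) x) = 1.
  apply: (tree_fun_cst hp ha hK _ Kx) => v' l.
  by rewrite -catA; exact: bump_tree_core.
have Du := energy_domain_tree hp ha hK m cV oV hV.
have d0 := delta_gt0 m (size w).+2.
have Eu := energy_tree hp ha hK m cV hV.
rewrite vertex_sum_bump in Eu.
rewrite -[leLHS]invrK invf_div.
apply: (@resistance_ge _ _ _ _ _ _ m _ _ _ (40 ^+ 2) u) => //.
- apply/eqP => xy; have := oner_neq0 R; rewrite -ux -uy xy eqxx//.
- by rewrite divr_gt0.
- move=> u' hu'.
  have := cell_dist ha hK m hu' [::] (attractor_Gword hK v Ky) (attractor_Gword hK (w ++ [:: i; j]) Kx).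
  by rewrite /= /delta big_ord0 mulr1.
- by rewrite Eu mulrC.
Qed.

End metric_bounds.

(** * Covers and Hausdorff measure *)

Section hausdorff_cover.
Context {R : realType} {T : Type} (d : T -> T -> R) (d0 : forall x y, 0 <= d x y).
Context (s : R) (s0 : 0 <= s).

Lemma diam_le (U : set T) (B : R) :
  (forall x y, U x -> U y -> d x y <= B) -> (diam d U <= B%:E)%E.
Proof.
by move=> H; apply: ge_ereal_sup => _ [[x y] [/= Ux Uy] <-]; rewrite lee_fin H.
Qed.

Lemma le_diam (U : set T) x y : U x -> U y -> ((d x y)%:E <= diam d U)%E.
Proof. by move=> Ux Uy; apply: ereal_sup_ubound; exists (x, y). Qed.

Lemma diam_ge0 (U : set T) x : U x -> (0 <= diam d U)%E.
Proof. by move=> Ux; apply: le_trans (le_diam Ux Ux); rewrite lee_fin. Qed.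

Lemma diam_pow_ge0 (U : set T) : (0 <= diam_pow d s U)%E.
Proof. by rewrite /diam_pow; case: ifP => // _; exact: poweR_ge0. Qed.

Lemma diam_pow_le (U : set T) (B : R) : (diam d U <= B%:E)%E ->
  (diam_pow d s U <= (B `^ s)%:E)%E.
Proof.
move=> UB; rewrite /diam_pow; case: eqVneq => [_|/set0P[x Ux]].
  by rewrite lee_fin powR_ge0.
rewrite -poweR_EFin; have [->|sn0] := eqVneq s 0; first by rewrite !poweRe0.
have s1 : 0 < s by rewrite lt_neqAle eq_sym sn0.
have U0 := diam_ge0 Ux.
by apply: gt0_ler_poweR => //; rewrite in_itv /= ?U0 ?leey//= (le_trans U0 UB).
Qed.

(** Finite covers are enough to find null sets, and can be glued together. *)
Definition fincover (eps eta : R) (A : set T) := exists l : seq (set T),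
  [/\ A = [set x | exists2 U, U \in l & U x],
      forall U, U \in l -> (diam d U <= eps%:E)%E &
      (\sum_(U <- l) diam_pow d s U <= eta%:E)%E].

Lemma fincover_premeasure eps eta A : fincover eps eta A ->
  (hausdorff_premeasure d s eps A <= eta%:E)%E.
Proof.
move=> [l [AE leps lsum]].
pose U n := nth set0 l n.
apply: (@le_trans _ _ (\sum_(0 <= n <oo) diam_pow d s (U n))%E).
  apply: ereal_inf_lbound; exists U => //; split.
    rewrite AE; apply/seteqP; split=> [x [n _ Unx]|x [V Vl Vx]].
      have [nl|ln] := ltnP n (size l); last by move: Unx; rewrite /U nth_default.
      by exists (U n) => //; exact: mem_nth.
    by exists (index V l) => //; rewrite /U nth_index.
  move=> n; have [nl|ln] := ltnP n (size l); first exact/leps/mem_nth.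
  rewrite /U nth_default// /diam (_ : [set _ | _ in _] = set0) ?ereal_sup0 ?leNye//.
  by rewrite -subset0 => _ [z [[]]].
rewrite (@nneseries_split _ _ 0 (size l)); last by move=> *; exact: diam_pow_ge0.
rewrite eseries0 ?adde0; last first.
  by move=> i il _; rewrite /U nth_default// /diam_pow eqxx.
by move: lsum; rewrite (big_nth set0) ?add0n.
Qed.

Lemma fincoverU eps eta1 eta2 A B : fincover eps eta1 A -> fincover eps eta2 B ->
  fincover eps (eta1 + eta2) (A `|` B).
Proof.
move=> [l [-> leps lsum]] [k [-> keps ksum]]; exists (l ++ k); split.
- apply/seteqP; split=> [x [[U Ul Ux]|[U Uk Ux]]|x [U]].
  + by exists U => //; rewrite mem_cat Ul.
  + by exists U => //; rewrite mem_cat Uk orbT.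
  + by rewrite mem_cat => /orP[Ul|Uk] Ux; [left|right]; exists U.
- by move=> U; rewrite mem_cat => /orP[/leps|/keps].
- by rewrite big_cat EFinD leeD.
Qed.

Lemma fincover0 eps : fincover eps 0 set0.
Proof.
exists [::]; split; rewrite ?big_nil//.
by apply/seteqP; split=> // x [].
Qed.

Lemma fincover_bigcup eps eta n (A : nat -> set T) :
  (forall i, (i < n)%N -> fincover eps eta (A i)) ->
  fincover eps (n%:R * eta) (\bigcup_(i in `I_n) A i).
Proof.
elim: n => [|n IH] H; first by rewrite II0 bigcup_set0 mul0r; exact: fincover0.
rewrite IIS bigcup_setU bigcup_set1 -natr1 mulrDl mul1r.
by apply: fincoverU; [apply: IH => i i_n; apply: H; exact: ltnW|exact: H].
Qed.

Lemma fincover_ord3 eps eta (A : 'I_3 -> set T) :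
  (forall i, fincover eps eta (A i)) -> fincover eps (3 * eta) (\bigcup_i A i).
Proof.
move=> H; have := @fincover_bigcup eps eta 3 (fun n => A (inord n)) (fun i _ => H _).
congr fincover; apply/seteqP; split=> [x [n _ Ax]|x [i _ Ax]]; first by exists (inord n).
by exists (val i) => /=; [exact: ltn_ord|rewrite inord_val].
Qed.

Lemma fincover1 eps (B : R) A : (diam d A <= B%:E)%E -> B <= eps ->
  fincover eps (B `^ s) A.
Proof.
move=> AB Beps; exists [:: A]; split.
- by apply/seteqP; split=> [x Ax|x [U]]; [exists A; rewrite ?inE|rewrite inE => /eqP ->].
- by move=> U; rewrite inE => /eqP ->; apply: le_trans AB _; rewrite lee_fin.
- by rewrite big_seq1 diam_pow_le.
Qed.

Lemma fincover_le eps eta eta' A : eta <= eta' -> fincover eps eta A ->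
  fincover eps eta' A.
Proof.
move=> ee [l [AE leps lsum]]; exists l; split=> //.
by apply: le_trans lsum _; rewrite lee_fin.
Qed.

Lemma hausdorff_measure_eq0 A :
  (forall eps eta, 0 < eps -> 0 < eta -> fincover eps eta A) ->
  hausdorff_measure d s A = 0%E.
Proof.
move=> H; apply/eqP; rewrite eq_le; apply/andP; split.
  apply: ge_ereal_sup => _ [eps eps0 <-]; apply/lee_addgt0Pr => eta eta0.
  by rewrite add0e; apply: fincover_premeasure; exact: H.
apply: (@le_trans _ _ (hausdorff_premeasure d s 1 A)).
  apply: le_ereal_inf_tmp => _ [U _ <-]; apply: nneseries_ge0 => n _ _.
  exact: diam_pow_ge0.
by apply: ereal_sup_ubound; exists 1 => //=; exact: ltr01.
Qed.

(** [N] pieces of diameter at most [N^-1] contribute [N `^ (1 - s)], which is small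
for large [N] as [1 < s]. *)
Lemma fincover_curve (xi : R -> T) eps eta : 1 < s ->
  (forall a b, 0 < a < 1 -> 0 < b < 1 -> d (xi a) (xi b) <= `|a - b|) ->
  0 < eps -> 0 < eta -> fincover eps eta (xi @` `]0, 1[).
Proof.
move=> s1 lip eps0 eta0.
have [N N0 [Neps Neta]] : exists2 N : nat, (0 < N)%N &
    N%:R^-1 <= eps /\ N%:R * (N%:R^-1 `^ s) <= eta.
  (* N%:R^-1 <= z amounts to N%:R `^ (1 - s) <= eta *)
  pose z := eta `^ (s - 1)^-1; have z0 : 0 < z by exact: powR_gt0.
  pose M := Num.max eps^-1 z^-1.
  have M0 : 0 < M by rewrite lt_max invr_gt0 eps0.
  pose N := (Num.truncn M).+1; have NM : M < N%:R by exact: truncnS_gt.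
  have N0 : 0 < N%:R :> R by exact: lt_trans NM.
  have [NMe NMz] : eps^-1 < N%:R /\ z^-1 < N%:R.
    by split; apply: le_lt_trans NM; rewrite le_max lexx ?orbT.
  exists N => //; split.
    by rewrite -[leRHS]invrK lef_pV2 ?posrE ?invr_gt0 ?ltW.
  set x := N%:R^-1; have x0 : 0 < x by rewrite invr_gt0.
  have xz : x <= z by rewrite -[leRHS]invrK lef_pV2 ?posrE ?invr_gt0 ?(ltW NMz).
  have -> : N%:R * x `^ s = x `^ (s - 1).
    have -> : x `^ s = x `^ (s - 1 + 1) by rewrite subrK.
    rewrite [x `^ (s - 1 + 1)]powRD; last by rewrite (gt_eqF x0) implybT.
    by rewrite powRr1 ?(ltW x0)// mulrCA /x mulfV ?mulr1// gt_eqF.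
  have -> : eta = z `^ (s - 1).
    by rewrite /z -powRrM mulVf ?powRr1 ?(ltW eta0)//; lra.
  by apply: ge0_ler_powR => //; rewrite ?nnegrE ?(ltW x0) ?(ltW z0)//; lra.
have Npos : 0 < N%:R :> R by rewrite ltr0n.
pose A j := xi @` [set t | 0 < t < 1 /\ Num.truncn (t * N%:R) = j].
have -> : xi @` `]0, 1[ = \bigcup_(j in `I_N) A j.
  apply/seteqP; split=> [y [t]|y [j _ [t [t01 _] <-]]]; last first.
    by exists t => //; rewrite /= in_itv.
  rewrite /= in_itv /= => /andP[t0 t1] <-; exists (Num.truncn (t * N%:R)).
    by rewrite /= truncn_lt_nat ?mulr_ge0 ?(ltW t0)// gtr_pMl.
  by exists t => //; split=> //; rewrite t0.
apply: (fincover_le Neta); apply: fincover_bigcup => j jN.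
apply: fincover1 => //; apply: diam_le => _ _ [a [a01 aj] <-] [b [b01 bj] <-].
apply: le_trans (lip _ _ a01 b01) _.
have /andP[a0 _] := a01; have /andP[b0 _] := b01.
have := truncn_itv (ltW (mulr_gt0 a0 Npos)); have := truncn_itv (ltW (mulr_gt0 b0 Npos)).
rewrite aj bj -natr1 => /andP[? ?] /andP[? ?].
rewrite -(ler_pM2r Npos) mulVf ?gt_eqF// -(ger0_norm (ltW Npos)) -normrM mulrBl.
by rewrite ler_norml; apply/andP; split; lra.
Qed.

End hausdorff_cover.

(** * Upper bound for the dimension *)

Lemma powR_exprn {R : realType} (q s : R) n : 0 <= q ->
  (q `^ s) ^+ n = (q ^+ n) `^ s.
Proof.
move=> q0; elim: n => [|n IH]; first by rewrite !expr0 powR1.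
by rewrite !exprS IH powRM// exprn_ge0.
Qed.

Section delta_growth.
Context {R : realType} (r_ rho_ : nat -> R) (r : R).
Context (m : forall i, matching_pair (r_ i) (rho_ i)) (rcv : r_ @ \oo --> r).

(** The constant absorbs the finitely many ratios that exceed [q]. *)
Lemma delta_upper (q : R) : 0 < q -> q <= 1 -> r < q ->
  exists2 C, 0 < C & forall n, delta r_ n <= C * q ^+ n.
Proof.
move=> q0 q1 rq.
have [M _ HM] : \forall n \near \oo, r_ n <= q.
  exact: (cvgr_le _ rcv).
exists (q ^- M); first by rewrite invr_gt0 exprn_gt0.
elim=> [|n IH].
  by rewrite expr0 mulr1 /delta big_ord0 invf_ge1 ?exprn_gt0// exprn_ile1// ltW.
have [Mn|nM] := leqP M n.
  rewrite deltaS exprSr mulrA; apply: ler_pM => //.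
  - exact: ltW (delta_gt0 m n).
  - by have [/ltW] := m n.
  - exact: HM.
apply: le_trans (delta_le1 m n.+1) _; rewrite mulrC ler_pdivlMr ?exprn_gt0// mul1r.
by apply: ler_wiXn2l => //; exact: ltW.
Qed.

Lemma delta_lower (q : R) : 0 < q -> q <= 1 -> q < r ->
  exists2 c, 0 < c & forall n, c * q ^+ n <= delta r_ n.
Proof.
move=> q0 q1 qr.
have [M _ HM] : \forall n \near \oo, q <= r_ n.
  exact: (cvgr_ge _ rcv).
exists (delta r_ M); first exact: (delta_gt0 m).
elim=> [|n IH].
  by rewrite expr0 mulr1 [leRHS]/delta big_ord0 (delta_le1 m).
have [Mn|nM] := leqP M n.
  rewrite deltaS exprSr mulrA; apply: ler_pM => //.
  - by rewrite mulr_ge0 ?exprn_ge0 ?(ltW q0)// (ltW (delta_gt0 m _)).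
  - exact: ltW.
  - exact: HM.
have dm : {homo delta r_ : a b / (a <= b)%N >-> b <= a}.
  apply/nonincreasing_seqP => k.
  by apply: le_trans (delta_le m k) _; have := delta_gt0 m k; lra.
apply: le_trans (dm _ _ nM); rewrite ler_piMr ?(ltW (delta_gt0 m _))//.
by rewrite exprn_ile1// ltW.
Qed.

(** For [0 < s], a ratio between [r] and the critical value [3 `^ (- s^-1)]; in all
cases [3 * mid_ratio s `^ s] and [3 * r `^ s] lie on the same side of 1. The
denominator [s + 1] keeps the formula meaningful at [s = 0]. *)
Definition mid_ratio (s : R) := expR (ln r - (ln 3 + s * ln r) / (2 * (s + 1))).

Lemma mid_ratio_powR s : 0 <= s ->
  3 * mid_ratio s `^ s = expR ((ln 3 + s * ln r) * ((s + 2) / (2 * (s + 1)))).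
Proof.
move=> s0; rewrite /mid_ratio /powR gt_eqF ?expR_gt0// expRK.
rewrite -{1}(@lnK _ 3) ?posrE// -expRD; congr expR; field; lra.
Qed.
End delta_growth.

Section hausdorff_upper.
Context {R : realType} (p : 'I_3 -> 'rV[R]_2) (alpha : R) (K : set 'rV[R]_2).
Context (ha : 0 < alpha < 1) (hK : hanoi_attractor p alpha K).
Context (r_ rho_ : nat -> R) (m : forall i, matching_pair (r_ i) (rho_ i)).
Local Notation Gw := (Gword p alpha).
Local Notation xi := (edge_param p alpha).
Local Notation rm := (resistance_metric p alpha r_ rho_ K).

Lemma cell_split w : Gw w @` K =
  (\bigcup_i (Gw (rcons w i) @` K)) `|` (\bigcup_i (xi w i @` `]0, 1[)).
Proof.
apply/seteqP; split=> [x [y Ky <-]|x [[i _ [y Ky <-]]|[i _ [t + <-]]]].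
- have [[i [z [Kz ->]]]|[i [t [t01 ->]]]] := attractor_cases hK Ky.
    by left; exists i => //; exists z; rewrite ?Gword_rcons.
  right; exists i => //; exists t; first by rewrite /= in_itv.
  by rewrite -edge_param_cat cats0.
- by rewrite Gword_rcons; exists (Gmap p alpha i y) => //; exact: (attractor_Gmap hK).
- rewrite /= in_itv /= => t01; exists (xi [::] i t); first exact: (attractor_first_edge hK).
  by rewrite -edge_param_cat cats0.
Qed.

(** [n] subdivisions of a cell leave [3 ^+ n] smaller cells, and finitely many
edges, whose contribution can be made as small as desired. *)
Lemma fincover_cell (s : R) (s1 : 1 < s) n w (eps eta : R) : 0 < eps -> 0 < eta ->
  40 ^+ 2 * delta r_ (size w + n) <= eps ->
  fincover rm s eps (3 ^+ n * (40 ^+ 2 * delta r_ (size w + n)) `^ s + eta) (Gw w @` K).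
Proof.
have s0 : 0 <= s by lra.
have d0 := resistance_ge0 p alpha K m.
elim: n w eta => [|n IH] w eta eps0 eta0.
  rewrite addn0 expr0 mul1r => deps.
  apply: (@fincover_le _ _ rm _ _ ((40 ^+ 2 * delta r_ (size w)) `^ s)).
    by rewrite lerDl ltW.
  apply: fincover1 => //; apply: diam_le => _ _ [x Kx <-] [y Ky <-].
  exact: (resistance_cell_le ha hK m).
rewrite addnS => deps; set B := _ `^ s.
(* eta is shared by three subcells and three edges *)
have eta6 : 0 < eta / 6 by rewrite divr_gt0.
have H1 : fincover rm s eps (3 * (3 ^+ n * B + eta / 6)) (\bigcup_i (Gw (rcons w i) @` K)).
  apply: fincover_ord3 => i.
  by have := IH (rcons w i) _ eps0 eta6; rewrite size_rcons addSn => /(_ deps).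
have H2 : fincover rm s eps (3 * (eta / 6)) (\bigcup_i (xi w i @` `]0, 1[)).
  apply: fincover_ord3 => i; apply: fincover_curve => // a b /andP[a0 a1] /andP[b0 b1].
  by apply: (resistance_edge_le ha hK m); rewrite !ltW.
rewrite cell_split (_ : _ + eta = 3 * (3 ^+ n * B + eta / 6) + 3 * (eta / 6)); last first.
  by rewrite exprS; field.
exact: fincoverU.
Qed.

(** The cells of level [n] contribute at most a constant times
[(3 * q `^ s) ^+ n], where [q] lies between [r] and the critical ratio, so that
[3 * q `^ s < 1]. *)
Lemma hausdorff_measure_above (r s : R) : 0 < r -> r_ @ \oo --> r -> 1 < s ->
  ln 3 + s * ln r < 0 -> hausdorff_measure rm s K = 0%E.
Proof.
move=> r0 rcv s1 sr; apply: hausdorff_measure_eq0 => eps eta eps0 eta0.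
have s0 : 0 < s by lra.
pose q := mid_ratio r s.
have q0 : 0 < q by exact: expR_gt0.
have qs : 0 <= 3 * q `^ s < 1.
  rewrite mulr_ge0 ?powR_ge0//= mid_ratio_powR ?(ltW s0)// expR_lt1.
  by rewrite nmulr_rlt0// divr_gt0//; lra.
have rq : r < q.
  rewrite -[ltLHS]lnK ?posrE// ltr_expR ltrDl oppr_gt0.
  by rewrite nmulr_rlt0// invr_gt0; lra.
have q1 : q < 1.
  rewrite ltNge; apply/negP => q1; have /andP[_] := qs; apply/negP; rewrite -leNgt.
  have : 1 <= q `^ s by rewrite -(powRr0 q) ler_powR// ltW.
  lra.
have [C C0 HC] := delta_upper m rcv q0 (ltW q1) rq.
have c1 : (fun n => 40 ^+ 2 * C * q ^+ n) @ \oo --> 0.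
  rewrite -[X in _ --> X](mulr0 (40 ^+ 2 * C)); apply: cvgMr; apply: cvg_expr.
  by rewrite ger0_norm// ltW.
have c2 : (fun n => (40 ^+ 2 * C) `^ s * (3 * q `^ s) ^+ n) @ \oo --> 0.
  rewrite -[X in _ --> X](mulr0 ((40 ^+ 2 * C) `^ s)); apply: cvgMr; apply: cvg_expr.
  by have /andP[? ?] := qs; rewrite ger0_norm.
have eta2 : 0 < eta / 2 by rewrite divr_gt0.
have N1 : \forall n \near \oo, 40 ^+ 2 * C * q ^+ n <= eps by exact: (cvgr_le _ c1).
have N2 : \forall n \near \oo, (40 ^+ 2 * C) `^ s * (3 * q `^ s) ^+ n <= eta / 2.
  exact: (cvgr_le _ c2).
have [n _ /(_ n (leqnn n)) [Hn1 Hn2]] := filterI N1 N2.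
have C40 : 0 <= 40 ^+ 2 :> R by exact: sqr_ge0.
have dn : 40 ^+ 2 * delta r_ n <= 40 ^+ 2 * C * q ^+ n.
  by rewrite -mulrA ler_wpM2l// HC.
have := @fincover_cell s s1 n [::] eps (eta / 2) eps0 eta2 (le_trans dn Hn1).
rewrite /= image_id; apply: fincover_le.
rewrite [leRHS]splitr lerD2r; apply: le_trans Hn2.
rewrite exprMn mulrCA ler_wpM2l ?exprn_ge0//.
rewrite powR_exprn ?(ltW q0)// -powRM ?mulr_ge0 ?exprn_ge0 ?(ltW C0) ?(ltW q0)//.
apply: ge0_ler_powR; rewrite ?nnegrE ?(ltW s0)//.
- by rewrite mulr_ge0// ltW// (delta_gt0 m).
- by rewrite mulr_ge0 ?exprn_ge0 ?mulr_ge0 ?(ltW C0) ?(ltW q0).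
Qed.

End hausdorff_upper.

(** * Lower bound for the dimension *)

Section hausdorff_lower.
Context {R : realType} (p : 'I_3 -> 'rV[R]_2) (alpha : R) (K : set 'rV[R]_2).
Context (hp : unit_equilateral p) (ha : 0 < alpha < 1)
  (hK : hanoi_attractor p alpha K).
Context (r_ rho_ : nat -> R) (m : forall i, matching_pair (r_ i) (rho_ i)).
Local Notation Gw := (Gword p alpha).
Local Notation rm := (resistance_metric p alpha r_ rho_ K).
Local Notation mu := (@lebesgue_measure R).

(** A cluster point, in the compact set [K], of a sequence of vertices of these
cells; each cell is closed and contains all but finitely many of them. *)
Lemma nested_cells_point (W B : nat -> seq 'I_3) :
  (forall j, W j.+1 = W j ++ B j) -> exists x, forall j, (Gw (W j) @` K) x.
Proof.
move=> WS.
pose y k := Gw (W k) (p ord0).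
have Kp := attractor_vertex ha hK ord0.
have yF j : \forall k \near \oo, (Gw (W j) @` K) (y k).
  exists j => // k /= jk; have [v Wk] : exists v, W k = W j ++ v.
    elim: k jk => [|k IH]; first by rewrite leqn0 => /eqP ->; exists [::]; rewrite cats0.
    rewrite leq_eqVlt => /predU1P[->|/IH[v Wk]]; first by exists [::]; rewrite cats0.
    by exists (v ++ B k); rewrite WS Wk catA.
  by exists (Gw v (p ord0)); [exact: (attractor_Gword hK)|rewrite /y Wk Gword_cat].
have Ky : \forall k \near \oo, K (y k) by apply: nearW => k; exact: (attractor_Gword hK).
have [x [Kx xcl]] := attractor_compact hK (F := y @ \oo) _ Ky.
exists x => j.
have clF : closed (Gw (W j) @` K).
  apply: compact_closed; first exact: norm_hausdorff.
  apply: continuous_compact; last exact: (attractor_compact hK).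
  by apply: continuous_subspaceT; exact: Gword_continuous.
by apply: clF => C xC; exact: (xcl _ _ (yF j) xC).
Qed.

Section address.
Context (L : nat).
Local Notation M := #|{: L.-tuple 'I_3}|.
Local Notation N := L.+2.

Lemma card_blocks : M = (3 ^ L)%N.
Proof. by rewrite card_tuple card_ord. Qed.

Lemma card_blocks_gt0 : (0 < M)%N.
Proof. by rewrite card_blocks expn_gt0. Qed.

(** The first [j] digits of [t] in base [M], the number of words of length [L],
read as one number. *)
Definition digits (j : nat) (t : R) : nat := Num.truncn (M%:R ^+ j * t).

Definition block (j : nat) (t : R) : L.-tuple 'I_3 :=
  enum_val (Ordinal (ltn_pmod (digits j.+1 t) card_blocks_gt0)).

(** Blocks of [L] free letters, which encode the digits of [t], are separated by
the letters [0 1]: this puts the point in a subsubcell that is separated from the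
other cells of the level reached by the block. *)
Fixpoint address (j : nat) (t : R) : seq 'I_3 :=
  if j is k.+1 then address k t ++ (block k t ++ [:: ord0; ordS ord0]) else [::].

Lemma size_address j t : size (address j t) = (j * N)%N.
Proof.
by elim: j => //= j IH; rewrite !size_cat IH size_tuple mulSn addn2 addnC.
Qed.

Lemma digits0 t : 0 <= t < 1 -> digits 0 t = 0%N.
Proof.
by move=> t01; apply: truncn_def; rewrite expr0 mul1r.
Qed.

Lemma card_blocks_exp_gt0 j : 0 < M%:R ^+ j :> R.
Proof. by rewrite exprn_gt0// ltr0n card_blocks_gt0. Qed.

Lemma digits_itv j t : 0 <= t ->
  (digits j t)%:R <= M%:R ^+ j * t < (digits j t)%:R + 1.
Proof.
by move=> t0; rewrite natr1; apply: truncn_itv; rewrite mulr_ge0// ltW// card_blocks_exp_gt0.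
Qed.

Lemma digitsS_div j t : 0 <= t -> (digits j.+1 t %/ M)%N = digits j t.
Proof.
move=> t0; apply/esym/truncn_def.
have /andP[a1 a2] := digits_itv j.+1 t0.
have M0 : 0 < M%:R :> R by rewrite ltr0n card_blocks_gt0.
rewrite exprS -mulrA in a1 a2.
apply/andP; split.
  rewrite -(ler_pM2l M0); apply: le_trans a1.
  by rewrite -natrM ler_nat mulnC leq_divM.
rewrite -(ltr_pM2l M0); apply: lt_le_trans a2 _.
by rewrite natr1 -natrM ler_nat mulnC ltn_ceil// card_blocks_gt0.
Qed.

Lemma address_inj j t t' : 0 <= t < 1 -> 0 <= t' < 1 ->
  address j t = address j t' -> digits j t = digits j t'.
Proof.
move=> t01 t01'; elim: j => [|j IH]; first by rewrite !digits0.
move=> /= /eqP; rewrite eqseq_cat ?size_address// eqseq_cat ?size_tuple// eqxx andbT.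
move=> /andP[/eqP /IH Dj /eqP /val_inj /enum_val_inj /(congr1 val) /= Dm].
have /andP[t0 _] := t01; have /andP[t0' _] := t01'.
by rewrite (divn_eq (digits j.+1 t) M) (divn_eq (digits j.+1 t') M) !digitsS_div// Dj Dm.
Qed.

Context (x : R -> 'rV[R]_2)
  (hx : forall t j, (Gw (address j t) @` K) (x t)).

(** Different digits give different words at the end of some block, and the two
letters after it allow the application of [resistance_separated_ge]. *)
Lemma address_sep j t t' : 0 <= t < 1 -> 0 <= t' < 1 ->
  digits j t != digits j t' -> delta r_ (j * N) / 6 <= rm (x t') (x t).
Proof.
move=> t01 t01'; case: j => [|j]; first by rewrite !digits0.
move=> Dtt'.
pose w := address j t ++ block j t; pose v := address j t' ++ block j t'.
have aw : address j.+1 t = w ++ [:: ord0; ordS ord0] by rewrite /w -catA.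
have av : address j.+1 t' = v ++ [:: ord0; ordS ord0] by rewrite /v -catA.
have [z Kz <-] := hx t j.+1; have [z' Kz' <-] := hx t' j.+1.
rewrite aw av (Gword_cat _ _ v).
have -> : (j.+1 * N)%N = (size w).+2.
  by rewrite -(size_address j.+1 t) aw size_cat addn2.
apply: (resistance_separated_ge hp ha hK m) => //.
- by rewrite !size_cat !size_address !size_tuple.
- apply: contraNneq Dtt' => vw; apply/eqP/address_inj => //.
  by rewrite aw av vw.
- exact: (attractor_Gword hK).
Qed.

Lemma digits_near j t t' : 0 <= t -> 0 <= t' -> digits j t = digits j t' ->
  `|t - t'| * M%:R ^+ j <= 1.
Proof.
move=> t0 t0' D; have := digits_itv j t0; have := digits_itv j t0'; rewrite D.
move=> /andP[? ?] /andP[? ?].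
rewrite -[X in _ * X](ger0_norm (ltW (card_blocks_exp_gt0 j))) -normrM mulrBl ler_norml.
by apply/andP; split; rewrite ![_ * M%:R ^+ j]mulrC; lra.
Qed.

(** If the diameter of [U] is below the separation of level [j], then the points
of [U] have the same first [j] digits, and their parameters lie in one interval of
length [M ^- j]. The last such [j] makes this length comparable to a power of the
diameter. If all [j] are such, there is at most one parameter. *)
Lemma preimage_cover (s A : R) (U : set 'rV[R]_2) : (1 < M)%N -> 0 <= s -> 0 < A ->
  (forall j, M%:R ^- j <= A * (delta r_ (j.+1 * N) / 6) `^ s) ->
  exists I : set R, [/\ measurable I,
    (fun t => 0 <= t < 1 /\ U (x t)) `<=` I & (mu I <= A%:E * diam_pow rm s U)%E].
Proof.
move=> M1 s0 A0 HA.
have [[t0 [t01 Ut0]]|noU] := pselect (exists t, 0 <= t < 1 /\ U (x t)); last first.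
  exists set0; split => //; first by move=> t Ut; apply: noU; exists t.
  by rewrite measure0 mule_ge0 ?lee_fin ?(ltW A0)// diam_pow_ge0.
have UU : U == set0 = false by apply/negP => /eqP U0; rewrite U0 in Ut0.
have Dcst j t : (diam rm U < (delta r_ (j * N) / 6)%:E)%E -> 0 <= t < 1 -> U (x t) ->
    digits j t = digits j t0.
  move=> Uj t01' Ut; apply/eqP; apply: contraTT Uj => Dj; rewrite -leNgt.
  apply: (le_trans _ (le_diam rm Ut Ut0)); rewrite lee_fin.
  by apply: address_sep => //; rewrite eq_sym.
have [[j Hj]|small] := pselect (exists j, ((delta r_ (j * N) / 6)%:E <= diam rm U)%E); last first.
  exists [set t0]; split=> //; last first.
    by rewrite lebesgue_measure_set1 mule_ge0 ?lee_fin ?(ltW A0)// diam_pow_ge0.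
  move=> t [t01' Ut] /=; apply/eqP; rewrite -subr_eq0; apply: contrapT => /negP tt0.
  have tt1 : 0 < `|t - t0| by rewrite normr_gt0.
  have M0 : 0 <= (M%:R^-1 : R) < 1.
    by rewrite invr_ge0 ler0n/= invf_lt1 ?ltr0n ?ltr1n// card_blocks_gt0.
  have Mcv : (fun n => (M%:R^-1 : R) ^+ n) @ \oo --> 0.
    by apply: cvg_expr; have /andP[? ?] := M0; rewrite ger0_norm.
  have [n _ /(_ n (leqnn n))] : \forall n \near \oo, (M%:R^-1 : R) ^+ n < `|t - t0|.
    exact: (cvgr_lt _ Mcv).
  rewrite exprVn invf_plt ?posrE ?card_blocks_exp_gt0//; apply/negP; rewrite -leNgt.
  have /andP[? _] := t01; have /andP[? _] := t01'.
  rewrite -(ler_pM2l tt1) mulfV ?gt_eqF//; apply: digits_near => //.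
  by apply: Dcst => //; rewrite ltNge; apply/negP => Hn; apply: small; exists n.
have [k Hk Dk] : exists2 k, ((delta r_ (k.+1 * N) / 6)%:E <= diam rm U)%E &
    forall t, 0 <= t < 1 -> U (x t) -> digits k t = digits k t0.
  pose P j := `[< ((delta r_ (j * N) / 6)%:E <= diam rm U)%E >].
  have exP : exists j, P j by exists j; apply/asboolP.
  have [[|k] /asboolP Hk kmin] := ex_minnP exP.
    exists 0%N; last by move=> t t01' _; rewrite !digits0.
    apply: le_trans Hk; rewrite lee_fin ler_pM2r//.
    have dm : {homo delta r_ : a b / (a <= b)%N >-> b <= a}.
      apply/nonincreasing_seqP => i.
      by apply: le_trans (delta_le m i) _; have := delta_gt0 m i; lra.
    exact: dm.
  exists k => // t t01' Ut; apply: Dcst => //; rewrite ltNge; apply/negP => Hk'.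
  by have := kmin k (asboolT Hk'); rewrite ltnn.
exists `[(digits k t0)%:R / M%:R ^+ k, ((digits k t0)%:R + 1) / M%:R ^+ k[%classic; split=> //.
  move=> t [t01' Ut]; rewrite /= in_itv /=.
  have /andP[t0' _] := t01'; have := digits_itv k t0'; rewrite (Dk t t01' Ut).
  by rewrite ler_pdivrMr ?card_blocks_exp_gt0// ltr_pdivlMr ?card_blocks_exp_gt0// [t * _]mulrC.
rewrite /= lebesgue_measure_itv /= lte_fin ltr_pM2r ?invr_gt0 ?card_blocks_exp_gt0// ltrDl ltr01.
rewrite -EFinB -mulrBl [_ + 1 - _]addrC addKr mul1r.
apply: (@le_trans _ _ (A * (delta r_ (k.+1 * N) / 6) `^ s)%:E); first by rewrite lee_fin.
rewrite EFinM lee_pmul2l ?lte_fin// /diam_pow UU -poweR_EFin.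
have [->|sn0] := eqVneq s 0; first by rewrite !poweRe0.
have s1 : 0 < s by rewrite lt_neqAle eq_sym sn0.
have d6 : 0 <= delta r_ (k.+1 * N) / 6 by rewrite divr_ge0// ltW// (delta_gt0 m).
apply: gt0_ler_poweR => //; rewrite in_itv /= leey ?lee_fin ?d6//.
by rewrite (le_trans _ Hk)// lee_fin.
Qed.

End address.

(** Mass distribution principle: the parameters of the sets of a cover fill the
unit interval, so their intervals have total length at least 1. The letters that
are not free cost a factor [q `^ (2 * s)] per block, and long blocks make up for
it, since [1 < 3 * q `^ s]. *)
Lemma hausdorff_measure_below (r s : R) : 0 < r < 1 -> r_ @ \oo --> r -> 0 <= s ->
  0 < ln 3 + s * ln r -> hausdorff_measure rm s K <> 0%E.
Proof.
move=> /andP[r0 r1] rcv s0 sr H0.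
pose q := mid_ratio r s.
have q0 : 0 < q by exact: expR_gt0.
have qs1 : 1 < 3 * q `^ s.
  rewrite mid_ratio_powR// expR_gt1; apply: mulr_gt0 => //.
  by apply: divr_gt0; lra.
have rq : q < r.
  rewrite -[ltRHS]lnK ?posrE// ltr_expR gtrDl oppr_lt0 divr_gt0//; lra.
have q1 : q <= 1 by lra.
have [c c0 Hc] := delta_lower m rcv q0 q1 rq.
have qsp : 0 < q `^ s by exact: powR_gt0.
(* the exponent 2 accounts for the two letters that end a block *)
have [L L0 HL] : exists2 L, (0 < L)%N & 1 <= (3 * q `^ s) ^+ L * (q `^ s) ^+ 2.
  have cv : (fun n => ((3 * q `^ s)^-1) ^+ n) @ \oo --> 0.
    apply: cvg_expr; rewrite ger0_norm ?invr_ge0; last lra.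
    by rewrite invf_lt1//; lra.
  have q2 : 0 < (q `^ s) ^+ 2 by exact: exprn_gt0.
  have [n _ Hn] : \forall n \near \oo, ((3 * q `^ s)^-1) ^+ n <= (q `^ s) ^+ 2.
    exact: (cvgr_le _ cv).
  exists n.+1 => //; have := Hn n.+1 (leqnSn n).
  have X0 : 0 < (3 * q `^ s) ^+ n.+1 by apply: exprn_gt0; lra.
  by rewrite exprVn -(ler_pdivrMl _ _ X0) mulr1.
pose M := #|{: L.-tuple 'I_3}|.
have ME : M%:R = 3 ^+ L :> R by rewrite /M card_blocks natrX.
have M1 : (1 < M)%N by rewrite /M card_blocks -{1}(expn0 3) ltn_exp2l.
have Mp : 0 < M%:R :> R by rewrite ltr0n (ltn_trans _ M1).
pose cs := (c / 6) `^ s; have cs0 : 0 < cs by apply: powR_gt0; lra.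
pose A := M%:R / cs.
have A0 : 0 < A by rewrite divr_gt0.
have HA j : M%:R ^- j <= A * (delta r_ (j.+1 * L.+2) / 6) `^ s.
  have h1 : cs * ((q `^ s) ^+ L.+2) ^+ j.+1 <= (delta r_ (j.+1 * L.+2) / 6) `^ s.
    have -> : ((q `^ s) ^+ L.+2) ^+ j.+1 = (q ^+ (j.+1 * L.+2)) `^ s.
      by rewrite -exprM mulnC powR_exprn// ltW.
    rewrite /cs -powRM ?exprn_ge0 ?(ltW q0)//; last lra.
    apply: ge0_ler_powR => //; rewrite ?nnegrE.
    - by rewrite mulr_ge0 ?exprn_ge0 ?(ltW q0)//; lra.
    - by rewrite divr_ge0// ltW// (delta_gt0 m).
    - by have := Hc (j.+1 * L.+2)%N; lra.
  have h2 : M%:R ^- j.+1 <= ((q `^ s) ^+ L.+2) ^+ j.+1.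
    rewrite -exprVn lerXn2r ?nnegrE ?invr_ge0 ?(ltW Mp)//.
      by rewrite exprn_ge0// ltW.
    rewrite -[leLHS]mul1r ler_pdivrMr// ME.
    by move: HL; rewrite exprMn -[L.+2]addn2 exprD; lra.
  apply: (@le_trans _ _ (A * (cs * M%:R ^- j.+1))).
    rewrite /A exprS invfM [leRHS](_ : _ = M%:R ^- j)//.
    by field; rewrite !gt_eqF ?exprn_gt0.
  rewrite ler_pM2l//; apply: le_trans h1; by rewrite ler_pM2l.
have [x hx] : exists x : R -> 'rV[R]_2, forall t j, (Gw (address L j t) @` K) (x t).
  have ex t : exists y, forall j, (Gw (address L j t) @` K) y.
    exact: (@nested_cells_point (address L ^~ t)
      (fun j => block L j t ++ [:: ord0; ordS ord0])).
  by exists (fun t => projT1 (cid (ex t))) => t; exact: (projT2 (cid (ex t))).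
have Kx t : K (x t) by have [z Kz <-] := hx t 0%N.
have : (hausdorff_premeasure rm s 1 K < (A^-1)%:E)%E.
  apply: (@le_lt_trans _ _ 0%E); last by rewrite lte_fin invr_gt0.
  by rewrite -H0; apply: ereal_sup_ubound; exists 1 => //=; exact: ltr01.
move=> /ereal_inf_lt[_ [U [UK _] <-] Usum].
have /choice[I HI] := fun n => preimage_cover hx (U n) M1 s0 A0 HA.
have : (mu `[0%R, 1%R[%classic <= \sum_(0 <= n <oo) mu (I n))%E.
  apply: measure_sigma_subadditive => //.
  - by move=> n; have [] := HI n.
  - move=> t /=; rewrite in_itv /= => t01.
    have : (\bigcup_n U n) (x t) by rewrite UK; exact: Kx.
    by move=> [n _ Unx]; exists n => //; have [_ sub _] := HI n; apply: sub.
rewrite /= lebesgue_measure_itv /= lte_fin ltr01 oppr0 adde0.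
apply/negP; rewrite -ltNge.
apply: (@le_lt_trans _ _ (\sum_(0 <= n <oo) A%:E * diam_pow rm s (U n))%E).
  by apply: lee_nneseries => [n _ _|n _]; [exact: measure_ge0|have [] := HI n].
rewrite nneseriesZl; last by move=> n _; exact: diam_pow_ge0.
rewrite -[1%E](_ : A%:E * (A^-1)%:E = 1)%E; last by rewrite -EFinM mulfV ?gt_eqF.
by rewrite lte_pmul2l// lte_fin.
Qed.

End hausdorff_lower.

(** * The dimension *)

(** The terms of a convergent series tend to 0; for [r = 3 / 5] the relation
[5 / 3 * r_ i + rho_ i = 1] transfers this from [rho_] to [r_]. *)
Lemma conditions_cvg (R : realType) (r_ rho_ : nat -> R) (r : R) :
  (forall i, matching_pair (r_ i) (rho_ i)) -> 1 / 3 <= r <= 3 / 5 ->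
  fulfills_conditions r_ rho_ r -> r_ @ \oo --> r.
Proof.
move=> m /andP[r1 r2] [H1 H2].
move: r2; rewrite le_eqVlt => /predU1P[rE|r2].
  have [/cvg_series_cvg_0 rho0 _] := H2 rE.
  have : (fun i => 3 / 5 * (1 - rho_ i)) @ \oo --> (3 / 5 * (1 - 0) : R).
    by apply: cvgMr; apply: cvgB => //; exact: cvg_cst.
  rewrite subr0 mulr1 rE; apply: cvg_trans; apply: near_eq_cvg.
  by apply: nearW => i; have [_ _ mi] := m i; lra.
have /H1/cvg_series_cvg_0 d0 : 1 / 3 <= r < 3 / 5 by rewrite r1.
apply/cvgrPdist_lt => e e0; move/cvgrPdist_lt : d0 => /(_ _ e0).
by apply: filterS => i; rewrite sub0r normrN normr_id.
Qed.

Theorem theorem4p4 (R : realType) (p : 'I_3 -> 'rV[R]_2) (alpha : R)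
    (K : set 'rV[R]_2) (r_ rho_ : nat -> R) (r : R)
    (hp : unit_equilateral p) (halpha : 0 < alpha < 1)
    (hK : hanoi_attractor p alpha K)
    (hmatch : forall i, matching_pair (r_ i) (rho_ i))
    (hr : 1 / 3 <= r <= 3 / 5)
    (hcond : fulfills_conditions r_ rho_ r) :
  hausdorff_dim (resistance_metric p alpha r_ rho_ K) K =
    (ln 3 / - ln r)%:E.
Proof.
have rcv := conditions_cvg hmatch hr hcond.
have /andP[r1 r2] := hr.
have r0 : 0 < r by lra.
have r1' : r < 1 by lra.
have lnr : 0 < - ln r by rewrite oppr_gt0 ln_lt0// r0.
have dim1 : 1 <= ln 3 / - ln r.
  rewrite ler_pdivlMr// mul1r -lnV ?posrE// ler_ln ?posrE ?invr_gt0//.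
  by rewrite -[leRHS]invrK lef_pV2 ?posrE ?invr_gt0//; lra.
apply/eqP; rewrite eq_le; apply/andP; split.
  apply/lee_addgt0Pr => e e0; apply: ereal_inf_lbound.
  exists (ln 3 / - ln r + e) => //; split; first by lra.
  apply: (hausdorff_measure_above halpha hK hmatch r0 rcv); first lra.
  have -> : ln 3 + (ln 3 / - ln r + e) * ln r = - (e * - ln r).
    by field; lra.
  by rewrite oppr_lt0 mulr_gt0.
apply: le_ereal_inf_tmp => _ [s [s0 Hs] <-]; rewrite lee_fin leNgt; apply/negP => sd.
apply: (@hausdorff_measure_below _ _ _ _ hp halpha hK _ _ hmatch r s) => //.
  by rewrite r0.
by move: sd; rewrite ltr_pdivlMr//; lra.
Qed.
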